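(* Let $a,b\in\mathbb{R}$ with $b\neq 0$, let $\Lambda=b\,Y_1\wedge Y_2+2b\,Y_2\wedge Y_3+a\,Y_3\wedge Y_1$ on $\mathbb{R}^3$, and let $\mathcal{R}$ be the complex of formal multivector fields with differential $[\Lambda,\cdot]$. Let $D=(x_1^2+x_2^2)x_3$. Then: (i) if $a\neq0$, $H^3(\mathcal{R})=H^3_{2,3}(\mathcal{R})\oplus H^3_{0,0}(\mathcal{R})=\mathbb{R}Y_{123}\oplus\mathbb{R}\partial_{123}$; (ii) if $a=0$, $$H^3(\mathcal{R})=\bigoplus_{k=1}^{\infty}H^3_{2k,3k}(\mathcal{R})\oplus\bigoplus_{m=0}^{\infty}H^3_{0,m}(\mathcal{R})\oplus\bigoplus_{m=1}^{\infty}H^3_{m,m}(\mathcal{R})$$ $$=\bigoplus_{m=0}^{\infty}\mathbb{R}\,D^{m}Y_{123}\oplus\bigoplus_{m=0}^{\infty}\mathbb{R}\,x_3^m\partial_{123}\oplus\bigoplus_{m=0}^{\infty}x_1^m(\mathbb{R}x_1+\mathbb{R}x_2)\partial_{123}.$$ (Infinite $\bigoplus$ over degrees denotes formal, possibly infinite, sums.)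
   Context: Coordinates $x_1,x_2,x_3$ on $\mathbb{R}^3$, $\partial_i=\partial/\partial x_i$, $\partial_{ij}=\partial_i\wedge\partial_j$, $\partial_{123}=\partial_1\wedge\partial_2\wedge\partial_3$. $Y_1=x_1\partial_1+x_2\partial_2$, $Y_2=x_1\partial_2-x_2\partial_1$, $Y_3=x_3\partial_3$ (pairwise commuting), $Y_{123}=Y_1\wedge Y_2\wedge Y_3$. $\Lambda$ is a Poisson tensor. $\mathcal{R}^d$ ($d=0,1,2,3$) is the space of $d$-vector fields on $\mathbb{R}^3$ with coefficients in $\mathbb{R}[[x_1,x_2,x_3]]$, and the differential is the Lichnerowicz–Poisson operator $[\Lambda,\cdot]$ (Schouten bracket), so $H(\mathcal{R})$ is the formal Poisson cohomology of $\Lambda$. Bigrading: for $0\le k\le r$ let $P_{kr}=\mathrm{span}_{\mathbb{R}}\{x_1^{\ell}x_2^{k-\ell}x_3^{r-k}:0\le\ell\le k\}$, and $P_{kr}=0$ otherwise. Put $\mathcal{R}^0_{kr}=P_{k-2,r-3}$, $\mathcal{R}^1_{kr}=P_{k-1,r-2}\partial_1+P_{k-1,r-2}\partial_2+P_{k-2,r-2}\partial_3$, $\mathcal{R}^2_{kr}=P_{k-1,r-1}\partial_{23}+P_{k-1,r-1}\partial_{31}+P_{k,r-1}\partial_{12}$, $\mathcal{R}^3_{kr}=P_{kr}\,\partial_{123}$. Then $\mathcal{R}^d$ is the space of formal sums of elements of the $\mathcal{R}^d_{kr}$ and the differential preserves $(k,r)$; $H^d_{k,r}(\mathcal{R})$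 denotes the degree-$d$ cohomology of the $(k,r)$-part. Writing a cohomology space as a space of cochains means that these cochains are cocycles and that each class has exactly one representative in that space. *)

(* Defs.v *)
From HB Require Import structures.
From mathcomp Require Import all_boot all_order all_algebra.
From mathcomp Require Import all_classical reals.

Set Implicit Arguments.
Unset Strict Implicit.
Unset Printing Implicit Defensive.

Import Order.TTheory GRing.Theory Num.Theory.
Local Open Scope classical_set_scope.
Local Open Scope ring_scope.

(* ---------------------------------------------------------------------- *)
(* Formal power series: [f : fps A] is its sequence of coefficients.      *)
(* The product is the Cauchy product, not the pointwise product of        *)
(* functions [nat -> A].                                                  *)
(* ---------------------------------------------------------------------- *)
Definition fps (A : Type) : Type := nat -> A.

#[warnings="-redundant-canonical-projection"]
HB.instance Definition _ (A : zmodType) :=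
  GRing.Zmodule.copy (fps A) (nat -> A).

Section FpsRing.
Variable A : comNzRingType.
Implicit Types (f g h : fps A) (c : A).

Definition fpsC c : fps A := fun n => if n == 0%N then c else 0.
Definition fpsX : fps A := fun n => (n == 1%N)%:R.
Definition fps_mul f g : fps A := fun n => \sum_(i < n.+1) f i * g (n - i)%N.
Definition fps_deriv f : fps A := fun n => f n.+1 *+ n.+1.

Fact fps_mulC : commutative fps_mul.
Proof.
move=> f g; apply/funext => n; rewrite /fps_mul (reindex_inj rev_ord_inj) /=.
by apply: eq_bigr => j _; rewrite (sub_ordK j) mulrC.
Qed.

Fact fps_mulA : associative fps_mul.
Proof.
move=> f g h; rewrite [RHS]fps_mulC [fps_mul g h]fps_mulC; apply/funext => n.
pose coef3 j k := f j * (h k * g (n - j - k)%N).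
transitivity (\sum_(j < n.+1) \sum_(k < n.+1 | (k <= n - j)%N) coef3 j k).
  apply: eq_bigr => /= j _; rewrite big_distrr /=.
  by rewrite (big_ord_narrow_leq (leq_subr _ _)).
rewrite (exchange_big_dep predT) //=; apply: eq_bigr => k _.
transitivity (\sum_(j < n.+1 | (j <= n - k)%N) coef3 j k).
  apply: eq_bigl => j; rewrite -ltnS -(ltnS j) -!subSn ?leq_ord //.
  by rewrite -subn_gt0 -(subn_gt0 j) -!subnDA addnC.
rewrite (big_ord_narrow_leq (leq_subr _ _)) /fps_mul big_distrr /=.
by apply: eq_bigr => j _; rewrite /coef3 -!subnDA addnC mulrCA.
Qed.

Fact fps_mul1 : left_id (fpsC 1) fps_mul.
Proof.
move=> f; apply/funext => n; rewrite /fps_mul big_ord_recl subn0 mul1r.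
by rewrite big1 ?addr0 // => j _; rewrite mul0r.
Qed.

Fact fps_mulDl : left_distributive fps_mul +%R.
Proof.
move=> f g h; apply/funext => n; rewrite [RHS]/GRing.add /= /fps_mul -big_split.
by apply: eq_bigr => j _; rewrite [LHS]mulrDl.
Qed.

Fact fps_oner_neq0 : fpsC 1 != 0.
Proof.
by apply/eqP => /(congr1 (fun f : fps A => f 0%N)) /eqP; rewrite oner_eq0.
Qed.

HB.instance Definition _ :=
  GRing.Zmodule_isComNzRing.Build (fps A)
  fps_mulA fps_mulC fps_mul1 fps_mulDl fps_oner_neq0.

End FpsRing.

Arguments fpsX {A}.

(* R[[x1, x2, x3]] as R[[x3]][[x2]][[x1]]:                                *)
(* [f i j l] is the coefficient of x1^i x2^j x3^l.                        *)
Notation fps3 R := (fps (fps (fps R))).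

(* The index n of x_(n+1) is an element of 'I_3 = {0, 1, 2}. *)
Notation i1 := (@Ordinal 3 0 isT).
Notation i2 := (@Ordinal 3 1 isT).
Notation i3 := (@Ordinal 3 2 isT).

(* A multivector field on R^3 with formal coefficients: [A J] is its      *)
(* coefficient on the wedge, in increasing order, of the \partial_j for   *)
(* j in J.  [^o] makes this type a module over R[[x1, x2, x3]].           *)
Notation mvf R := {ffun {set 'I_3} -> (fps3 R)^o}.

Section Multivectors.
Variable R : realType.
Implicit Types (f : fps3 R) (A B L : mvf R) (I J K : {set 'I_3}).

Definition scal (c : R) : fps3 R := fpsC (fpsC (fpsC c)).

Definition x1 : fps3 R := fpsX.
Definition x2 : fps3 R := fpsC fpsX.
Definition x3 : fps3 R := fpsC (fpsC fpsX).

Definition dx (n : 'I_3) f : fps3 R :=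
  match val n with
  | 0 => fps_deriv f
  | 1 => fun i => fps_deriv (f i)
  | _ => fun i j => fps_deriv (f i j)
  end.

(* A function, seen as a 0-vector field. *)
Definition mvf0 f : mvf R := [ffun J => if J == finset.set0 then f else 0].

Definition pd (n : 'I_3) : mvf R :=
  [ffun J => if J == [set n]%SET then 1 else 0].

(* Sign of the permutation that sorts the concatenation of two increasing *)
(* words with disjoint sets of letters I and J.                           *)
Definition shuffle_sign I J : fps3 R :=
  (-1) ^+ #|[set p : 'I_3 * 'I_3 |
              [&& p.1 \in I, p.2 \in J & (p.2 < p.1)%N]]%SET|.

Definition wedge A B : mvf R :=
  [ffun K : {set 'I_3} => \sum_(I : {set 'I_3} | I \subset K)
     shuffle_sign I (K :\: I)%SET * (A I * B (K :\: I)%SET)].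

(* With \partial_n regarded as an odd variable zeta_n, a multivector      *)
(* field is a superfunction of (x, zeta).  The right (left) derivative    *)
(* in zeta_n first moves zeta_n to the right (left) end of the word.      *)
Definition dzeta_right (n : 'I_3) A : mvf R :=
  [ffun J : {set 'I_3} => if n \in J then 0
    else (-1) ^+ #|[set j in J | (n < j)%N]%SET| * A (n |: J)%SET].
Definition dzeta_left (n : 'I_3) A : mvf R :=
  [ffun J : {set 'I_3} => if n \in J then 0
    else (-1) ^+ #|[set j in J | (j < n)%N]%SET| * A (n |: J)%SET].
Definition dx_mvf (n : 'I_3) A : mvf R := [ffun J => dx n (A J)].

(* The Schouten bracket, normalized so that it is the Lie bracket on      *)
(* vector fields and [X, f] = X f.  The usual sign (-1)^((p-1)(q-1)) of   *)
(* the second term is absorbed by the use of left derivatives there.      *)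
Definition schouten A B : mvf R :=
  \sum_(n < 3) (wedge (dzeta_right n A) (dx_mvf n B)
              - wedge (dx_mvf n A) (dzeta_left n B)).

Definition pd12 : mvf R := wedge (pd i1) (pd i2).
Definition pd23 : mvf R := wedge (pd i2) (pd i3).
Definition pd31 : mvf R := wedge (pd i3) (pd i1).
Definition pd123 : mvf R := wedge (wedge (pd i1) (pd i2)) (pd i3).

Definition Y1 : mvf R := x1 *: pd i1 + x2 *: pd i2.
Definition Y2 : mvf R := x1 *: pd i2 - x2 *: pd i1.
Definition Y3 : mvf R := x3 *: pd i3.
Definition Y123 : mvf R := wedge (wedge Y1 Y2) Y3.

Definition multivectors (d : nat) : set (mvf R) :=
  [set A | forall J, #|J| != d -> A J = 0].

(* The indices are integers, so that k - 2, r - 3, ... in [bigraded] are  *)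
(* not truncated.                                                         *)
Definition Pkr (k r : int) : set (fps3 R) :=
  [set f | if (0 <= k <= r) then
             exists c : nat -> R,
               f = \sum_(l < `|k|%N.+1) scal (c l) *
                     (x1 ^+ l * x2 ^+ (`|k|%N - l)%N * x3 ^+ `|r - k|%N)
           else f = 0].

Definition bigraded (kr : nat * nat) (d : nat) : set (mvf R) :=
  let k := kr.1%:Z in let r := kr.2%:Z in
  match d with
  | 0 => [set A | exists2 f, Pkr (k - 2) (r - 3) f & A = mvf0 f]
  | 1 => [set A | exists f g h,
            [/\ Pkr (k - 1) (r - 2) f, Pkr (k - 1) (r - 2) g,
                Pkr (k - 2) (r - 2) h
              & A = f *: pd i1 + g *: pd i2 + h *: pd i3]]
  | 2 => [set A | exists f g h,
            [/\ Pkr (k - 1) (r - 1) f, Pkr (k - 1) (r - 1) g, Pkr k (r - 1) h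
              & A = f *: pd23 + g *: pd31 + h *: pd12]]
  | 3 => [set A | exists2 f, Pkr k r f & A = f *: pd123]
  | _ => [set 0]
  end.

(* Below, [C : nat -> set (mvf R)] is a graded space preserved by the     *)
(* differential [schouten L]: [multivectors], or [bigraded kr].           *)
Definition cocycles L (C : nat -> set (mvf R)) (d : nat) : set (mvf R) :=
  [set A | C d A /\ schouten L A = 0].

Definition coboundaries L (C : nat -> set (mvf R)) (d : nat) : set (mvf R) :=
  if d is e.+1 then [set schouten L B | B in C e] else [set 0].

Definition cohomology_is L (C : nat -> set (mvf R)) (d : nat)
    (V : set (mvf R)) : Prop :=
  V `<=` cocycles L C d /\
  forall A, cocycles L C d A ->
    exists! v, V v /\ coboundaries L C d (A - v).

Definition line A : set (mvf R) := [set scal c *: A | c in [set: R]].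

Section FormalSums.
Variable T : choiceType.

Definition summable (v : T -> mvf R) : Prop :=
  forall J i j l, finite_set [set t | v t J i j l != 0].

(* Coefficientwise sum of a family, meaningful if it is [summable]. *)
Definition formal_sum (v : T -> mvf R) : mvf R :=
  [ffun J => (fun i j l => \sum_(t \in [set: T]) v t J i j l) : fps3 R].

Definition families (V : T -> set (mvf R)) : set (T -> mvf R) :=
  [set v | forall t, V t (v t)].

Definition formal_dsum (V : T -> set (mvf R)) : set (mvf R) :=
  [set formal_sum v | v in families V].

Definition dsum_is_direct (V : T -> set (mvf R)) : Prop :=
  (forall v, families V v -> summable v) /\
  {in families V &, injective formal_sum}.

(* The map (class of v_t)_t |-> class of (sum_t v_t), from the product    *)
(* of the cohomologies in the bidegrees [kr t] to the full cohomology, is *)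
(* well defined, injective and surjective.                                *)
Definition cohomology_is_dsum L (d : nat) (kr : T -> nat * nat) : Prop :=
  let Z := families (fun t => cocycles L (bigraded (kr t)) d) in
  let B := families (fun t => coboundaries L (bigraded (kr t)) d) in
  [/\ forall v, Z v ->
        summable v /\ cocycles L multivectors d (formal_sum v),
      forall v, Z v ->
        (B v <-> coboundaries L multivectors d (formal_sum v))
    & forall A, cocycles L multivectors d A ->
        exists2 v, Z v & coboundaries L multivectors d (A - formal_sum v)].

End FormalSums.

End Multivectors.

Arguments x1 {R}.
Arguments x2 {R}.
Arguments x3 {R}.
Arguments pd {R}.
Arguments pd123 {R}.
Arguments Y1 {R}.
Arguments Y2 {R}.
Arguments Y3 {R}.
Arguments Y123 {R}.
Arguments multivectors {R}.
Arguments bigraded {R}.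

(* Main.v *)
(* A trivector field f pd123 is automatically closed, and it is exact iff    *)
(* f = Lambda . curl B + B . curl Lambda for some triple B of series.  This  *)
(* operator is homogeneous, so everything reduces to one finite-dimensional  *)
(* cokernel for each degree k in (x1, x2) and each degree n in x3.  By       *)
(* duality the cokernel is described by the functionals on the span of the   *)
(* x1^i x2^j x3^n, i + j = k, that kill the image; they solve an explicit    *)
(* linear recurrence.  For k, n > 0 and k <> 2n it has no nonzero solution.  *)
(* For k = 2n the image of the rotation field x1 pd2 - x2 pd1, shifted by    *)
(* a (2 - k), comes in: it is everything unless a (2 - k) = 0, by skew       *)
(* symmetry, and then the only functional is the rotation-invariant one,     *)
(* which does not vanish on D^n.  For n = 0 and a = 0 the image consists of  *)
(* the multiples of x1^2 + x2^2, and the functionals are evaluations at the  *)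
(* complex zeros of x1^2 + x2^2.                                             *)
Require Import Defs.
From HB Require Import structures.
From mathcomp Require Import all_boot all_order all_algebra.
From mathcomp Require Import all_classical reals.
From mathcomp Require Import ring lra zify.

Set Implicit Arguments.
Unset Strict Implicit.
Unset Printing Implicit Defensive.

Import Order.TTheory GRing.Theory Num.Theory.
Local Open Scope classical_set_scope.
Local Open Scope ring_scope.

(** * Formal power series *)

(** On a three-dimensional space every trivector field [f *: pd123] is a cocycle, and
    [schouten_Lambda] identifies the bracket of [Lambda] with bivector fields as [- delta]; so H^3
    is the cokernel of [delta] on formal series. [delta] respects the bidegree (k, n), with k the
    degree in x1, x2 and n = r - k the degree in x3 ([hpart_delta]), and primitives of the
    homogeneous parts glue ([exact_hpartP]). It therefore suffices to find the cokernel for each (k,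
    n).

    By finite-dimensional duality ([pairing_exact], [exact_pairing]) the part of bidegree (k, n) of
    a series is exact iff it pairs to 0 with every solution of the recurrences [annihilator]. For k
    > 0 the solution space is zero if n > 0 and k <> 2n ([annihilator_generic]), if n > 0 and a (2 -
    k) <> 0 ([annihilator_skew]), and if n = 0 and a <> 0 ([annihilator_n0]). It is the line of
    Gaussian moments if k = 2n and a (1 - n) = 0 ([annihilator_gauss], [annihilator_gauss_uniq]),
    and a plane if n = 0 and a = 0 ([annihilator_zero_wt], [annihilator_zero_uniq]). For k = 0 a
    single value is left, killed exactly when n > 0 and a <> 0.

    So the surviving (k, n) are (0, 0) and (2, 1) if a <> 0, and (2n, n), (0, n), (k, 0) if a = 0.
    The representatives in the theorem are series on which the surviving functionals are
    nondegenerate ([exact_complement_D], [exact_complement_x3], [exact_complement_linear]), and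
    [top_cohomology_dsum] assembles the bidegrees. *)

Section FpsCoefficients.
Variable A : comNzRingType.
Implicit Types f g : fps A.

Lemma fps_addE f g n : (f + g) n = f n + g n. Proof. by []. Qed.

Lemma fps_oppE f n : (- f) n = - f n. Proof. by []. Qed.

Lemma fps_mulrnE f m n : (f *+ m) n = f n *+ m.
Proof. by elim: m => // m IHm; rewrite !mulrS fps_addE IHm. Qed.

Lemma fps_sumE (I : Type) (r : seq I) (P : pred I) (F : I -> fps A) n :
  (\sum_(t <- r | P t) F t) n = \sum_(t <- r | P t) F t n.
Proof. exact: (big_morph (fun f : fps A => f n)). Qed.

Lemma fpsC_mulE c f n : (fpsC c * f) n = c * f n.
Proof.
rewrite [LHS]big_ord_recl subn0 /= big1 ?addr0 // => j _.
by rewrite /fpsC /= mul0r.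
Qed.

Lemma fpsX_mulE f n : (fpsX * f) n = if n is m.+1 then f m else 0.
Proof.
case: n => [|n]; rewrite [LHS]big_ord_recl /fpsX mul0r add0r ?big_ord0 //.
rewrite big_ord_recl /= mul1r subSS subn0 big1 ?addr0 // => j _.
by rewrite mul0r.
Qed.

Fact fpsC_is_zmod_morphism : zmod_morphism (@fpsC A).
Proof.
move=> c d; apply/funext => n; rewrite fps_addE fps_oppE /fpsC.
by case: ifP => //; rewrite subrr.
Qed.

Fact fpsC_is_monoid_morphism : monoid_morphism (@fpsC A).
Proof.
split=> // c d; apply/funext => n; rewrite fpsC_mulE /fpsC.
by case: ifP; rewrite ?mulr0.
Qed.

HB.instance Definition _ :=
  GRing.isZmodMorphism.Build A (fps A) (@fpsC A) fpsC_is_zmod_morphism.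
HB.instance Definition _ :=
  GRing.isMonoidMorphism.Build A (fps A) (@fpsC A) fpsC_is_monoid_morphism.

End FpsCoefficients.

Section Fps3.
Variable R : realType.
Implicit Types (f g h : fps3 R) (c : R).

Fact scal_is_zmod_morphism : zmod_morphism (@scal R).
Proof. by move=> c d; rewrite /scal !rmorphB. Qed.

Fact scal_is_monoid_morphism : monoid_morphism (@scal R).
Proof. by split=> [|c d]; rewrite /scal ?rmorph1 // !rmorphM. Qed.

HB.instance Definition _ :=
  GRing.isZmodMorphism.Build R (fps3 R) (@scal R) scal_is_zmod_morphism.
HB.instance Definition _ :=
  GRing.isMonoidMorphism.Build R (fps3 R) (@scal R) scal_is_monoid_morphism.

Lemma fps3P f g : (forall i j l, f i j l = g i j l) -> f = g.
Proof. by move=> fg; do 3!apply/funext => ?. Qed.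

Lemma scalE c f i j l : (scal c * f) i j l = c * f i j l.
Proof. by rewrite /scal !fpsC_mulE. Qed.

Lemma x1E f i j l : (x1 * f) i j l = if i is i'.+1 then f i' j l else 0.
Proof. by rewrite /x1 fpsX_mulE; case: i. Qed.

Lemma x2E f i j l : (x2 * f) i j l = if j is j'.+1 then f i j' l else 0.
Proof. by rewrite /x2 fpsC_mulE fpsX_mulE; case: j. Qed.

Lemma x3E f i j l : (x3 * f) i j l = if l is l'.+1 then f i j l' else 0.
Proof. by rewrite /x3 !fpsC_mulE fpsX_mulE. Qed.

Lemma dx1E f i j l : dx i1 f i j l = f i.+1 j l *+ i.+1.
Proof. by rewrite /dx /fps_deriv /= !fps_mulrnE. Qed.

Lemma dx2E f i j l : dx i2 f i j l = f i j.+1 l *+ j.+1.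
Proof. by rewrite /dx /fps_deriv /= !fps_mulrnE. Qed.

Lemma dx3E f i j l : dx i3 f i j l = f i j l.+1 *+ l.+1.
Proof. by []. Qed.

Lemma ord3_ind (P : 'I_3 -> Prop) : P i1 -> P i2 -> P i3 -> forall n, P n.
Proof.
by move=> P1 P2 P3 [[|[|[|//]]] lt_n3];
  [move: P1 | move: P2 | move: P3]; congr P; apply: val_inj.
Qed.

Lemma dx_is_zmod_morphism n : zmod_morphism (@dx R n).
Proof.
move=> f g; apply/fps3P => i j l.
have coefB u v i' j' l' :
  (u - v : fps3 R) i' j' l' = u i' j' l' - v i' j' l' by [].
rewrite coefB; elim/ord3_ind: n.
- by rewrite !dx1E coefB mulrnBl.
- by rewrite !dx2E coefB mulrnBl.
- by rewrite !dx3E coefB mulrnBl.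
Qed.

HB.instance Definition _ n :=
  GRing.isZmodMorphism.Build (fps3 R) (fps3 R) (@dx R n)
    (dx_is_zmod_morphism n).

Definition mon i j l : fps3 R := x1 ^+ i * x2 ^+ j * x3 ^+ l.

Lemma x1_mon i j l : x1 * mon i j l = mon i.+1 j l.
Proof. by rewrite /mon exprS !mulrA. Qed.

Lemma x2_mon i j l : x2 * mon i j l = mon i j.+1 l.
Proof. by rewrite /mon exprS -!mulrA mulrCA. Qed.

Lemma x3_mon i j l : x3 * mon i j l = mon i j l.+1.
Proof. by rewrite /mon exprS mulrCA. Qed.

Lemma monE i j l i' j' l' :
  mon i j l i' j' l' = [&& i' == i, j' == j & l' == l]%:R.
Proof.
elim: i i' => [|i IHi] i'; last by rewrite -x1_mon x1E; case: i'.
elim: j j' => [|j IHj] j'; last first.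
  by rewrite -x2_mon x2E; case: j' => // *; rewrite andbF.
elim: l l' => [|l IHl] l'; last first.
  by rewrite -x3_mon x3E; case: l' => // *; rewrite !andbF.
by rewrite /mon !expr0 !mulr1; case: i' j' l' => [|?] [|?] [|?].
Qed.

Lemma dx1_mon i j l : dx i1 (mon i j l) = mon i.-1 j l *+ i.
Proof.
apply/fps3P => i' j' l'; rewrite dx1E !fps_mulrnE !monE.
by case: i => [|i] /=; rewrite ?mul0rn // eqSS;
  case: (i' =P i) => [->|_]; rewrite ?mul0rn.
Qed.

Lemma dx2_mon i j l : dx i2 (mon i j l) = mon i j.-1 l *+ j.
Proof.
apply/fps3P => i' j' l'; rewrite dx2E !fps_mulrnE !monE.
by case: j => [|j] /=; rewrite ?andbF ?mul0rn // eqSS;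
  case: (j' =P j) => [->|_]; rewrite ?andbF ?mul0rn.
Qed.

Lemma dx3_mon i j l : dx i3 (mon i j l) = mon i j l.-1 *+ l.
Proof.
apply/fps3P => i' j' l'; rewrite dx3E !fps_mulrnE !monE.
by case: l => [|l] /=; rewrite ?andbF ?mul0rn // eqSS;
  case: (l' =P l) => [->|_]; rewrite ?andbF ?mul0rn.
Qed.

Lemma dx_scal n c f : dx n (scal c * f) = scal c * dx n f.
Proof.
apply/fps3P => i j l; rewrite scalE; elim/ord3_ind: n.
- by rewrite !dx1E scalE mulrnAr.
- by rewrite !dx2E scalE mulrnAr.
- by rewrite !dx3E scalE mulrnAr.
Qed.

Lemma dx1_x1 f : dx i1 (x1 * f) = f + x1 * dx i1 f.
Proof.
apply/fps3P => i j l; rewrite !fps_addE dx1E !x1E.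
by case: i => [|i]; [rewrite mulr1n addr0 | rewrite dx1E mulrS].
Qed.

Lemma dx1_x2 f : dx i1 (x2 * f) = x2 * dx i1 f.
Proof. by apply/fps3P => i [|j] l; rewrite dx1E !x2E ?dx1E ?mul0rn. Qed.

Lemma dx1_x3 f : dx i1 (x3 * f) = x3 * dx i1 f.
Proof. by apply/fps3P => i j [|l]; rewrite dx1E !x3E ?dx1E ?mul0rn. Qed.

Lemma dx2_x1 f : dx i2 (x1 * f) = x1 * dx i2 f.
Proof. by apply/fps3P => [[|i]] j l; rewrite dx2E !x1E ?dx2E ?mul0rn. Qed.

Lemma dx2_x2 f : dx i2 (x2 * f) = f + x2 * dx i2 f.
Proof.
apply/fps3P => i j l; rewrite !fps_addE dx2E !x2E.
by case: j => [|j]; [rewrite mulr1n addr0 | rewrite dx2E mulrS].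
Qed.

Lemma dx2_x3 f : dx i2 (x3 * f) = x3 * dx i2 f.
Proof. by apply/fps3P => i j [|l]; rewrite dx2E !x3E ?dx2E ?mul0rn. Qed.

Lemma dx3_x1 f : dx i3 (x1 * f) = x1 * dx i3 f.
Proof. by apply/fps3P => [[|i]] j l; rewrite dx3E !x1E ?dx3E ?mul0rn. Qed.

Lemma dx3_x2 f : dx i3 (x2 * f) = x2 * dx i3 f.
Proof. by apply/fps3P => i [|j] l; rewrite dx3E !x2E ?dx3E ?mul0rn. Qed.

Lemma dx3_x3 f : dx i3 (x3 * f) = f + x3 * dx i3 f.
Proof.
apply/fps3P => i j l; rewrite !fps_addE dx3E !x3E.
by case: l => [|l]; [rewrite mulr1n addr0 | rewrite dx3E mulrS].
Qed.

Lemma dxr1 n : dx n (1 : fps3 R) = 0.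
Proof.
have -> : 1 = mon 0 0 0 by rewrite /mon !expr0 !mul1r.
by elim/ord3_ind: n; rewrite ?(dx1_mon, dx2_mon, dx3_mon) mulr0n.
Qed.

End Fps3.

(** * Bihomogeneous parts of series *)

Section Homogeneous.
Variable R : realType.
Implicit Types (f g h : fps3 R) (c : R) (k n : int).

(** The degrees are integers so that the shifts k - 1 and n - 1 below are not truncated; a part of
    negative degree is 0. *)
Definition hpart k n f : fps3 R := fun i j l =>
  if ((i + j)%N%:Z == k) && (l%:Z == n) then f i j l else 0.

Fact hpart_is_zmod_morphism k n : zmod_morphism (hpart k n).
Proof.
move=> f g; apply/fps3P => i j l; rewrite !fps_addE !fps_oppE /hpart.
by case: ifP => _; rewrite ?subrr.
Qed.

HB.instance Definition _ k n :=
  GRing.isZmodMorphism.Build (fps3 R) (fps3 R) (hpart k n)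
    (hpart_is_zmod_morphism k n).

Lemma hpart_scal k n c f : hpart k n (scal c * f) = scal c * hpart k n f.
Proof.
by apply/fps3P => i j l; rewrite scalE /hpart scalE; case: ifP; rewrite ?mulr0.
Qed.

Lemma hpart_x1 k n f : hpart k n (x1 * f) = x1 * hpart (k - 1) n f.
Proof.
apply/fps3P => i j l; rewrite /hpart !x1E; case: i => [|i]; first by case: ifP.
by congr (if _ && _ then _ else _); lia.
Qed.

Lemma hpart_x2 k n f : hpart k n (x2 * f) = x2 * hpart (k - 1) n f.
Proof.
apply/fps3P => i j l; rewrite /hpart !x2E; case: j => [|j]; first by case: ifP.
by congr (if _ && _ then _ else _); lia.
Qed.

Lemma hpart_x3 k n f : hpart k n (x3 * f) = x3 * hpart k (n - 1) f.
Proof.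
apply/fps3P => i j l; rewrite /hpart !x3E; case: l => [|l]; first by case: ifP.
by congr (if _ && _ then _ else _); lia.
Qed.

Lemma hpart_dx1 k n f : hpart k n (dx i1 f) = dx i1 (hpart (k + 1) n f).
Proof.
apply/fps3P => i j l; rewrite dx1E /hpart dx1E.
have -> : ((i.+1 + j)%N%:Z == k + 1) = ((i + j)%N%:Z == k) by lia.
by case: ifP => _; rewrite ?mul0rn.
Qed.

Lemma hpart_dx2 k n f : hpart k n (dx i2 f) = dx i2 (hpart (k + 1) n f).
Proof.
apply/fps3P => i j l; rewrite dx2E /hpart dx2E.
have -> : ((i + j.+1)%N%:Z == k + 1) = ((i + j)%N%:Z == k) by lia.
by case: ifP => _; rewrite ?mul0rn.
Qed.

Lemma hpart_dx3 k n f : hpart k n (dx i3 f) = dx i3 (hpart k (n + 1) f).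
Proof.
apply/fps3P => i j l; rewrite dx3E /hpart dx3E.
have -> : (l.+1%:Z == n + 1) = (l%:Z == n) by lia.
by case: ifP => _; rewrite ?mul0rn.
Qed.

Lemma hpart_hpart k n k' n' f :
  hpart k n (hpart k' n' f) = if (k == k') && (n == n') then hpart k n f else 0.
Proof.
apply/fps3P => i j l; rewrite /hpart;
  case: (boolP ((k == k') && _)) => [/andP[/eqP-> /eqP->]|kn].
  by case: (_ && _).
by case: ifP => // /andP[/eqP-> /eqP->]; rewrite (negbTE kn).
Qed.

Lemma hpart_id k n f : hpart k n (hpart k n f) = hpart k n f.
Proof. by rewrite hpart_hpart !eqxx. Qed.

Lemma hpart_eq0 k n f : (k < 0) || (n < 0) -> hpart k n f = 0.
Proof.
move=> kn_lt0; apply/fps3P => i j l; rewrite /hpart; case: ifP => //; lia.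
Qed.

Lemma eq_hpart f g :
  (forall k n : nat, hpart k%:Z n%:Z f = hpart k%:Z n%:Z g) -> f = g.
Proof.
move=> fg; apply/fps3P => i j l.
move/(congr1 (fun u : fps3 R => u i j l)): (fg (i + j)%N l).
by rewrite /hpart !eqxx.
Qed.

Lemma hpart_mon k n i j l :
  hpart k n (mon R i j l) =
  if ((i + j)%N%:Z == k) && (l%:Z == n) then mon R i j l else 0.
Proof.
apply/fps3P => i' j' l'; rewrite /hpart (monE _ i j).
have [-> | ne_i] := eqVneq i' i; last first.
  by case: ifP; case: ifP => *; rewrite ?(monE _ i j) ?(negbTE ne_i).
have [-> | ne_j] := eqVneq j' j; last first.
  by case: ifP; case: ifP => *; rewrite ?(monE _ i j) ?eqxx ?(negbTE ne_j).
have [-> | ne_l] := eqVneq l' l; last first.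
  by case: ifP; case: ifP => *; rewrite ?(monE _ i j) ?eqxx ?(negbTE ne_l).
by case: ifP => *; rewrite ?(monE _ i j) ?eqxx.
Qed.

Lemma hpart_sum (k n : nat) f :
  hpart k n f = \sum_(i < k.+1) scal (f i (k - i)%N n) * mon R i (k - i) n.
Proof.
apply/fps3P => i j l; rewrite !fps_sumE /hpart.
under eq_bigr do rewrite scalE monE.
case: ifP => [/andP[/eqP[<-] /eqP[<-]]|kn].
  have lt_i : (i < (i + j).+1)%N by rewrite ltnS leq_addr.
  rewrite (bigD1 (Ordinal lt_i)) //= !addKn !eqxx mulr1 big1 ?addr0 // => t.
  rewrite -val_eqE /= => ne_t; rewrite (_ : (i == t) = false) ?mulr0 //.
  by rewrite eq_sym; apply/negbTE.
rewrite big1 // => t _; rewrite (_ : [&& _, _ & _] = false) ?mulr0 //.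
by apply/negP => /and3P[/eqP it /eqP jt /eqP ln]; have := ltn_ord t; lia.
Qed.

(** Here r is the total degree, so r - k is the degree in x3. Outside 0 <= k <= r both sides say f =
    0. *)
Lemma Pkr_hpart k r f : Pkr k r f <-> hpart k (r - k) f = f.
Proof.
rewrite /Pkr /=; case: ifP => [/andP[k_ge0 kr]|kr]; last first.
  split=> [->|<-]; first by rewrite raddf0.
  by apply: hpart_eq0; lia.
case: k k_ge0 kr => // k _ kr; rewrite absz_nat.
have -> : r - k%:Z = `|r - k%:Z|%N%:Z by lia.
rewrite absz_nat; set n := `|_|%N.
split=> [[c ->]|<-].
  rewrite raddf_sum; apply: eq_bigr => i _ /=.
  by rewrite hpart_scal hpart_mon subnKC ?eqxx // -ltnS.
by exists (fun i => f i (k - i)%N n); rewrite hpart_sum.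
Qed.

End Homogeneous.

(** * The top differential *)

Section Delta.
Variables (R : realType) (a b : R).
Implicit Types (f g h : fps3 R) (c : R) (k n : int).

(* [Lambda, B] = - delta B for B = f pd23 + g pd31 + h pd12: this is         *)
(* Lambda . curl B + B . curl Lambda.                                        *)
Definition delta f g h : fps3 R :=
  x3 * ((scal (2 * b) * x1 - scal a * x2) * (dx i2 h - dx i3 g)
      + (scal (2 * b) * x2 + scal a * x1) * (dx i3 f - dx i1 h))
  + scal b * (x1 ^+ 2 + x2 ^+ 2) * (dx i1 g - dx i2 f)
  - scal a * (x1 * f + x2 * g - 2%:R * (x3 * h)).

Lemma deltaD f g h f' g' h' :
  delta (f + f') (g + g') (h + h') = delta f g h + delta f' g' h'.
Proof. by rewrite /delta !raddfD /=; ring. Qed.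

Lemma delta_scal c f g h :
  delta (scal c * f) (scal c * g) (scal c * h) = scal c * delta f g h.
Proof. by rewrite /delta !dx_scal; ring. Qed.

Lemma hpart_delta k n f g h :
  hpart k n (delta f g h) =
  delta (hpart (k - 1) n f) (hpart (k - 1) n g) (hpart k (n - 1) h).
Proof.
(* Each term is written with one coordinate applied at a time, so that [hpart] passes every factor
   by its own commutation rule. *)
have deltaE u v w : delta u v w =
  x3 * (scal (2 * b) * (x1 * (dx i2 w - dx i3 v))
        - scal a * (x2 * (dx i2 w - dx i3 v))
      + (scal (2 * b) * (x2 * (dx i3 u - dx i1 w))
        + scal a * (x1 * (dx i3 u - dx i1 w))))
  + scal b * (x1 * (x1 * (dx i1 v - dx i2 u)) + x2 * (x2 * (dx i1 v - dx i2 u)))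
  - scal a * (x1 * u + x2 * v - (x3 * w + x3 * w)).
  by rewrite /delta; ring.
rewrite !deltaE.
do 8!rewrite ?(raddfD, raddfB, raddfN, hpart_scal, hpart_x1, hpart_x2,
  hpart_x3) /=.
by rewrite !(hpart_dx1, hpart_dx2, hpart_dx3) !subrK.
Qed.

Definition exact : set (fps3 R) :=
  [set F | exists f g h, F = delta f g h].

Lemma exact0 : exact 0.
Proof.
by exists 0, 0, 0; rewrite /delta !raddf0; ring.
Qed.

Lemma exactD f g : exact f -> exact g -> exact (f + g).
Proof.
move=> [u [v [w ->]]] [u' [v' [w' ->]]].
by exists (u + u'), (v + v'), (w + w'); rewrite deltaD.
Qed.

Lemma exact_scal c f : exact f -> exact (scal c * f).
Proof.
move=> [u [v [w ->]]].
by exists (scal c * u), (scal c * v), (scal c * w); rewrite delta_scal.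
Qed.

Lemma exactN f : exact f -> exact (- f).
Proof. by move/(exact_scal (-1)); rewrite rmorphN rmorph1 mulN1r. Qed.

Lemma exactB f g : exact f -> exact g -> exact (f - g).
Proof. by move=> ef eg; apply: exactD => //; apply: exactN. Qed.

Lemma exact_sum (I : Type) (r : seq I) (F : I -> fps3 R) :
  (forall t, exact (F t)) -> exact (\sum_(t <- r) F t).
Proof.
by move=> eF; elim/big_ind: _ => //; [exact: exact0 | exact: exactD].
Qed.

Lemma hpart_exact k n f : exact f -> exact (hpart k n f).
Proof. by move=> [u [v [w ->]]]; rewrite hpart_delta; do 3!eexists. Qed.

(* The homogeneous parts of a primitive can be chosen independently, so      *)
(* primitives of the homogeneous parts glue.                                 *)
Lemma exact_hpartP f :
  (forall k n : nat, exact (hpart k%:Z n%:Z f)) -> exact f.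
Proof.
move=> ef.
have /choice[F /choice[G /choice[H fE]]] :
  forall kn : nat * nat, exists u v w,
    hpart kn.1%:Z kn.2%:Z f = delta u v w by move=> kn; exact: ef.
(* The coefficient of u or v at (i, j, l) only contributes to bidegree (i + j + 1, l), that of w to
   (i + j, l + 1); it is copied from the primitive chosen there. *)
pose u i j l := F ((i + j).+1, l) i j l.
pose v i j l := G ((i + j).+1, l) i j l.
pose w i j l := H ((i + j)%N, l.+1) i j l.
exists u, v, w; apply: eq_hpart => k n.
rewrite -hpart_id (fE (k, n)) !hpart_delta.
have -> : hpart (k%:Z - 1) n u = hpart (k%:Z - 1) n (F (k, n)).
  apply/fps3P => i j l; rewrite /hpart; case: ifP => // /andP[ijk ln].
  have [ij_k l_n] : (i + j).+1 = k /\ l = n by lia.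
  by rewrite /u ij_k l_n.
have -> : hpart (k%:Z - 1) n v = hpart (k%:Z - 1) n (G (k, n)).
  apply/fps3P => i j l; rewrite /hpart; case: ifP => // /andP[ijk ln].
  have [ij_k l_n] : (i + j).+1 = k /\ l = n by lia.
  by rewrite /v ij_k l_n.
have -> // : hpart k (n%:Z - 1) w = hpart k (n%:Z - 1) (H (k, n)).
apply/fps3P => i j l; rewrite /hpart; case: ifP => // /andP[ijk ln].
have [ij_k l_n] : (i + j)%N = k /\ l.+1 = n by lia.
by rewrite /w ij_k l_n.
Qed.

End Delta.

(** * Functionals, and the operator on monomials *)

Section Monomials.
Variables (R : realType) (a b : R).
Implicit Types (f g h : fps3 R) (c : R) (wt : nat -> nat -> R) (k n : nat).
Local Notation mon := (mon R).
Local Notation delta := (delta a b).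

Lemma hpart_ind (P : fps3 R -> Prop) (k n : int) f :
    P 0 -> (forall u v, P u -> P v -> P (u + v)) ->
    (forall c u, P u -> P (scal c * u)) ->
    (forall i j l : nat, (i + j)%N%:Z = k -> l%:Z = n -> P (mon i j l)) ->
  P (hpart k n f).
Proof.
move=> P0 PD PZ Pmon.
have [kn_lt0|] := boolP ((k < 0) || (n < 0)); first by rewrite hpart_eq0.
rewrite negb_or -!leNgt => /andP[]; case: k Pmon => // k Pmon _.
case: n Pmon => // n Pmon _.
rewrite hpart_sum; apply: big_ind => // i _; apply/PZ/Pmon => //.
by rewrite subnKC // -ltnS.
Qed.

(** The functional on bidegree (k, n) with value [wt i j] on x1^i x2^j x3^n; only the values with i
    + j = k enter. *)
Definition pairing wt k n f : R
  := \sum_(i < k.+1) wt i (k - i)%N * f i (k - i)%N n.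

Fact pairing_is_zmod_morphism wt k n : zmod_morphism (pairing wt k n).
Proof.
move=> f g; rewrite /pairing -sumrB; apply: eq_bigr => i _.
by rewrite !fps_addE !fps_oppE mulrBr.
Qed.

HB.instance Definition _ wt k n :=
  GRing.isZmodMorphism.Build (fps3 R) R (pairing wt k n)
    (pairing_is_zmod_morphism wt k n).

Lemma pairing_scal wt k n c f : pairing wt k n (scal c * f)
  = c * pairing wt k n f.
Proof. by rewrite mulr_sumr; apply: eq_bigr => i _; rewrite scalE mulrCA. Qed.

Lemma pairing_hpart wt k n f : pairing wt k n (hpart k n f) = pairing wt k n f.
Proof.
apply: eq_bigr => i _; rewrite /hpart.
by rewrite subnKC ?eqxx // -ltnS.
Qed.

Lemma pairing_mon wt k n i j :
  (i + j)%N = k -> pairing wt k n (mon i j n) = wt i j.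
Proof.
move=> <-; have lt_i : (i < (i + j).+1)%N by rewrite ltnS leq_addr.
rewrite /pairing (bigD1 (Ordinal lt_i)) //= monE addKn !eqxx mulr1 big1 ?addr0
  //.
move=> t; rewrite -val_eqE /= => ne_t.
by rewrite monE (negbTE ne_t) mulr0.
Qed.

(** Truncated predecessors such as [j.-1] are harmless here and in the two analogues below: the
    monomial then carries the factor j = 0. *)
Lemma delta1_mon i j n :
  delta (mon i j n) 0 0 = scal ((n%:R - 1) * a) * mon i.+1 j n
    + scal (b * (2 * n%:R - j%:R)) * mon i j.+1 n
    - scal (b * j%:R) * mon i.+2 j.-1 n.
Proof.
have x2j : x2 * (mon i j.-1 n *+ j) = mon i j n *+ j.
  by case: j => [|j]; rewrite ?mulr0n ?mulr0 // mulrnAr x2_mon.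
have x3n : x3 * (mon i j n.-1 *+ n) = mon i j n *+ n.
  by case: n {x2j} => [|n]; rewrite ?mulr0n ?mulr0 // mulrnAr x3_mon.
rewrite /delta !raddf0 dx2_mon dx3_mon -!x1_mon -x2_mon.
transitivity ((scal (2 * b) * x2 + scal a * x1) * (x3 * (mon i j n.-1 *+ n))
  - scal b * (x1 * (x1 * (mon i j.-1 n *+ j)) + x2 * (x2 * (mon i j.-1 n *+ j)))
  - scal a * x1 * mon i j n); first by ring.
by rewrite x2j x3n; ring.
Qed.

Lemma delta2_mon i j n :
  delta 0 (mon i j n) 0 = scal ((n%:R - 1) * a) * mon i j.+1 n
    + scal (b * (i%:R - 2 * n%:R)) * mon i.+1 j n
    + scal (b * i%:R) * mon i.-1 j.+2 n.
Proof.
have x1i : x1 * (mon i.-1 j n *+ i) = mon i j n *+ i.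
  by case: i => [|i]; rewrite ?mulr0n ?mulr0 // mulrnAr x1_mon.
have x3n : x3 * (mon i j n.-1 *+ n) = mon i j n *+ n.
  by case: n {x1i} => [|n]; rewrite ?mulr0n ?mulr0 // mulrnAr x3_mon.
rewrite /delta !raddf0 dx1_mon dx3_mon -!x2_mon -x1_mon.
transitivity (- (scal (2 * b) * x1 - scal a * x2) * (x3 * (mon i j n.-1 *+ n))
  + scal b * (x1 * (x1 * (mon i.-1 j n *+ i)) + x2 * (x2 * (mon i.-1 j n *+ i)))
  - scal a * x2 * mon i j n); first by ring.
by rewrite x1i x3n; ring.
Qed.

Lemma delta3_mon i j n :
  delta 0 0 (mon i j n) = scal (2 * b * j%:R) * mon i.+1 j.-1 n.+1
    - scal (2 * b * i%:R) * mon i.-1 j.+1 n.+1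
    + scal (a * (2 - (i + j)%:R)) * mon i j n.+1.
Proof.
have x2j : x2 * (mon i j.-1 n *+ j) = mon i j n *+ j.
  by case: j => [|j]; rewrite ?mulr0n ?mulr0 // mulrnAr x2_mon.
have x1i : x1 * (mon i.-1 j n *+ i) = mon i j n *+ i.
  by case: i {x2j} => [|i]; rewrite ?mulr0n ?mulr0 // mulrnAr x1_mon.
rewrite /delta !raddf0 dx1_mon dx2_mon -!x3_mon -x1_mon -x2_mon natrD.
transitivity (x3 * (scal (2 * b) * (x1 * (mon i j.-1 n *+ j)
  - x2 * (mon i.-1 j n *+ i))
  - scal a * (x2 * (mon i j.-1 n *+ j) + x1 * (mon i.-1 j n *+ i))
      + 2 * scal a * mon i j n)); first by ring.
by rewrite x2j x1i; ring.
Qed.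

End Monomials.

(** * Functionals killing the exact series *)

Section Fredholm.
Variables (R : realType) (a b : R).
Implicit Types (f g h : fps3 R) (c : R) (wt : nat -> nat -> R) (k n : nat).
Local Notation mon := (mon R).
Local Notation delta := (delta a b).
Local Notation exact := (exact a b).

(* The equations saying that the functional with value wt i j on             *)
(* x1^i x2^j x3^n, where i + j = k, kills the exact series; they come from   *)
(* the three formulas delta[123]_mon.                                        *)
Definition annihilator k n wt : Prop :=
  [/\ forall i j, (i + j).+1 = k ->
        (n%:R - 1) * a * wt i.+1 j + b * (2 * n%:R - j%:R) * wt i j.+1
        - b * j%:R * wt i.+2 j.-1 = 0,
      forall i j, (i + j).+1 = k ->
        (n%:R - 1) * a * wt i j.+1 + b * (i%:R - 2 * n%:R) * wt i.+1 j
        + b * i%:R * wt i.-1 j.+2 = 0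
    & (0 < n)%N -> forall i j, (i + j)%N = k ->
        2 * b * j%:R * wt i.+1 j.-1 - 2 * b * i%:R * wt i.-1 j.+1
        + a * (2 - k%:R) * wt i j = 0].

Lemma pairing_delta1 wt k n i j : (i + j).+1 = k ->
  pairing wt k n (delta (mon i j n) 0 0) =
    (n%:R - 1) * a * wt i.+1 j + b * (2 * n%:R - j%:R) * wt i j.+1
    - b * j%:R * wt i.+2 j.-1.
Proof.
move=> <-; rewrite delta1_mon raddfB raddfD /= !pairing_scal.
rewrite (@pairing_mon _ wt _ n i.+1 j) //.
rewrite (@pairing_mon _ wt _ n i j.+1) ?addnS //.
congr (_ + _ - _).
case: j => [|j]; first by rewrite !mulr0 !mul0r.
by rewrite pairing_mon //= !addSn addnS.
Qed.

Lemma pairing_delta2 wt k n i j : (i + j).+1 = k ->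
  pairing wt k n (delta 0 (mon i j n) 0) =
    (n%:R - 1) * a * wt i j.+1 + b * (i%:R - 2 * n%:R) * wt i.+1 j
    + b * i%:R * wt i.-1 j.+2.
Proof.
move=> <-; rewrite delta2_mon !raddfD /= !pairing_scal.
rewrite (@pairing_mon _ wt _ n i.+1 j) //.
rewrite (@pairing_mon _ wt _ n i j.+1) ?addnS //.
congr (_ + _ + _).
case: i => [|i]; first by rewrite !mulr0 !mul0r.
by rewrite pairing_mon //= !addnS addSn.
Qed.

Lemma pairing_delta3 wt k n i j : (i + j)%N = k ->
  pairing wt k n.+1 (delta 0 0 (mon i j n)) =
    2 * b * j%:R * wt i.+1 j.-1 - 2 * b * i%:R * wt i.-1 j.+1
    + a * (2 - k%:R) * wt i j.
Proof.
move=> <-; rewrite delta3_mon raddfD raddfB /= !pairing_scal.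
rewrite (@pairing_mon _ wt _ n.+1 i j) //; congr (_ - _ + _).
  case: j => [|j]; first by rewrite !mulr0 !mul0r.
  by rewrite pairing_mon //= addnS.
case: i => [|i]; first by rewrite !mulr0 !mul0r.
by rewrite pairing_mon //= addnS.
Qed.

(** Only the parts of bidegree (k - 1, n), (k - 1, n), (k, n - 1) of a primitive matter; by
    linearity they may be taken to be monomials, where the three families of equations apply. *)
Lemma pairing_exact wt k n f :
  annihilator k n wt -> exact f -> pairing wt k n f = 0.
Proof.
move=> [wt1 wt2 wt3] [u [v [w ->]]].
rewrite -pairing_hpart hpart_delta.
have deltaE u' v' w' : delta u' v' w' = delta u' 0 0 + delta 0 v' 0
  + delta 0 0 w'.
  by rewrite -!deltaD !add0r !addr0.
have deltaZ1 c u' : delta (scal c * u') 0 0 = scal c * delta u' 0 0.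
  by rewrite -delta_scal mulr0.
have deltaZ2 c u' : delta 0 (scal c * u') 0 = scal c * delta 0 u' 0.
  by rewrite -delta_scal mulr0.
have deltaZ3 c u' : delta 0 0 (scal c * u') = scal c * delta 0 0 u'.
  by rewrite -delta_scal mulr0.
have delta0 : delta 0 0 0 = 0 by rewrite /delta !raddf0; ring.
have pairingD g h : pairing wt k n (g + h) = pairing wt k n g
  + pairing wt k n h.
  exact: raddfD.
have e1 : pairing wt k n (delta (hpart (k%:Z - 1) n u) 0 0) = 0.
  apply: (hpart_ind (P := fun u' => pairing wt k n (delta u' 0 0) = 0)).
  - by rewrite delta0 raddf0.
  - move=> u' v' eu ev; have := deltaD a b u' 0 0 v' 0 0.
    by rewrite !addr0 => ->; rewrite pairingD eu ev addr0.
  - by move=> c u' eu; rewrite deltaZ1 pairing_scal eu mulr0.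
  - move=> i j l ijk [->]; have {}ijk : (i + j).+1 = k by lia.
    by rewrite pairing_delta1 // wt1.
have e2 : pairing wt k n (delta 0 (hpart (k%:Z - 1) n v) 0) = 0.
  apply: (hpart_ind (P := fun u' => pairing wt k n (delta 0 u' 0) = 0)).
  - by rewrite delta0 raddf0.
  - move=> u' v' eu ev; have := deltaD a b 0 u' 0 0 v' 0.
    by rewrite !addr0 => ->; rewrite pairingD eu ev addr0.
  - by move=> c u' eu; rewrite deltaZ2 pairing_scal eu mulr0.
  - move=> i j l ijk [->]; have {}ijk : (i + j).+1 = k by lia.
    by rewrite pairing_delta2 // wt2.
have e3 : pairing wt k n (delta 0 0 (hpart k (n%:Z - 1) w)) = 0.
  apply: (hpart_ind (P := fun u' => pairing wt k n (delta 0 0 u') = 0)).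
  - by rewrite delta0 raddf0.
  - move=> u' v' eu ev; have := deltaD a b 0 0 u' 0 0 v'.
    by rewrite !addr0 => ->; rewrite pairingD eu ev addr0.
  - by move=> c u' eu; rewrite deltaZ3 pairing_scal eu mulr0.
  - move=> i j l [ijk] ln; have n_eq : n = l.+1 by lia.
    by rewrite n_eq pairing_delta3 // wt3 // n_eq.
by rewrite deltaE 2!pairingD e1 e2 e3 !addr0.
Qed.

(* The exact series of one bidegree form the span of finitely many vectors,  *)
(* so they are cut out by the functionals that kill them.                    *)
Lemma exact_pairing k n f :
  (forall wt, annihilator k n wt -> pairing wt k n f = 0) ->
  exact (hpart k%:Z n%:Z f).
Proof.
move=> f_ann.
(* One generator for each monomial in each component that reaches (k, n): the first two blocks are
   empty for k = 0, and the third is 0 for n = 0. *)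
pose T := ('I_k + 'I_k + 'I_k.+1)%type.
pose gen (t : T) := match t with
  | inl (inl i) => delta (mon i (k.-1 - i) n) 0 0
  | inl (inr i) => delta 0 (mon i (k.-1 - i) n) 0
  | inr i => if n is m.+1 then delta 0 0 (mon i (k - i) m) else 0
  end.
have gen_exact t : exact (gen t).
  case: t => [[i|i]|i]; rewrite /gen; do ?by do 3!eexists.
  by case: n {f_ann gen} => [|m]; [exact: exact0 | do 3!eexists].
pose cmx g : 'rV[R]_k.+1 := \row_i g i (k - i)%N n.
pose G := \matrix_(t < #|{: T}|) cmx (gen (enum_val t)).
(* Each column of [cokermx G] is a functional killing all generators, hence an annihilator; a vector
   killed by all these columns lies in the row space of [G]. *)
have /submxP[D fE] : (cmx f <= G)%MS.
  rewrite submxE; apply/eqP/rowP => s; rewrite [RHS]mxE.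
  pose wt i (j : nat) := cokermx G (inord i) s.
  have wtE g : pairing wt k n g = (cmx g *m cokermx G) 0 s.
    rewrite mxE; apply: eq_bigr => i _.
    by rewrite [cmx g _ _]mxE /wt inord_val mulrC.
  have wt_gen t : pairing wt k n (gen t) = 0.
    rewrite wtE; have /rowP/(_ s) := congr1 (row (enum_rank t)) (mulmx_coker G).
    by rewrite row_mul rowK enum_rankK row0 => ->; rewrite mxE.
  have <- := f_ann wt; first by rewrite wtE.
  split=> [i j ijk|i j ijk|n_gt0 i j ijk].
  - have lt_ik : (i < k)%N by lia.
    rewrite -(pairing_delta1 wt n ijk)
      -[RHS](wt_gen (inl (inl (Ordinal lt_ik)))) /=.
    by rewrite (_ : (k.-1 - i)%N = j) //; lia.
  - have lt_ik : (i < k)%N by lia.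
    rewrite -(pairing_delta2 wt n ijk)
      -[RHS](wt_gen (inl (inr (Ordinal lt_ik)))) /=.
    by rewrite (_ : (k.-1 - i)%N = j) //; lia.
  - have lt_ik : (i < k.+1)%N by lia.
    rewrite -(pairing_delta3 wt n.-1 ijk) -[RHS](wt_gen (inr (Ordinal lt_ik)))
      /=.
    by rewrite (_ : (k - i)%N = j) ?prednK //; [case: (n) n_gt0 | lia].
have -> : hpart k n f = \sum_t scal (D 0 t) * hpart k n (gen (enum_val t)).
  rewrite hpart_sum; under [RHS]eq_bigr do rewrite hpart_sum mulr_sumr.
  rewrite exchange_big /=; apply: eq_bigr => i _.
  have -> : f i (k - i)%N n = cmx f 0 i by rewrite mxE.
  rewrite fE mxE raddf_sum mulr_suml; apply: eq_bigr => t _.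
  by rewrite /= !mxE rmorphM /= mulrA.
by apply: exact_sum => t; apply/exact_scal/hpart_exact.
Qed.

End Fredholm.

(** * Solving the recurrences *)

Section Annihilators.
Variables (R : realType) (a b : R).
Hypothesis b_neq0 : b != 0.
Implicit Types (f g h : fps3 R) (c : R) (wt : nat -> nat -> R) (k n : nat).
Local Notation mon := (mon R).
Local Notation exact := (exact a b).
Local Notation annihilator := (annihilator a b).

(** Twice an equation of the first or second family plus one of the third eliminates the outer value
    and leaves 2n - k times a p + 2 b q, respectively a q - 2 b p, for adjacent values p and q. The
    determinant a^2 + 4 b^2 of this system is positive. *)
Lemma annihilator_generic k n wt i j :
    (0 < k)%N -> (0 < n)%N -> k != (2 * n)%N -> annihilator k n wt ->
  (i + j)%N = k -> wt i j = 0.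
Proof.
move=> k_gt0 n_gt0 k_neq [wt1 wt2 wt3].
suff wt0 i' j' : (i' + j').+1 = k -> wt i'.+1 j' = 0 /\ wt i' j'.+1 = 0.
  case: j => [|j] ijk; last by case: (wt0 i j) => //; rewrite -addnS.
  case: i ijk => [|i] ijk; first by rewrite -ijk in k_gt0.
  by case: (wt0 i 0%N).
move=> ijk; set p := wt i'.+1 j'; set q := wt i' j'.+1.
have dk : 2 * n%:R - k%:R != 0 :> R.
  by rewrite subr_eq0 -natrM eqr_nat eq_sym.
have kE : k%:R = i'%:R + j'%:R + 1 :> R by rewrite -ijk -addn1 !natrD.
have pq1 : a * p + 2 * b * q = 0.
  apply: (mulfI dk); rewrite mulr0.
  have := wt1 i' j' ijk; have := wt3 n_gt0 i'.+1 j' ijk.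
  rewrite -/p /= -/q -natr1 kE; lra.
have pq2 : a * q - 2 * b * p = 0.
  apply: (mulfI dk); rewrite mulr0.
  have := wt2 i' j' ijk; have := wt3 n_gt0 i' j'.+1; rewrite addnS => /(_ ijk).
  rewrite -/p /= -/q -natr1 kE; lra.
have d_neq0 : a ^+ 2 + 4 * b ^+ 2 != 0.
  by rewrite gt_eqF // ltr_wpDl ?sqr_ge0 // mulr_gt0 // exprn_even_gt0.
split; apply: (mulfI d_neq0); rewrite mulr0.
  transitivity (a * (a * p + 2 * b * q) - 2 * b * (a * q - 2 * b * p));
    first by ring.
  by rewrite pq1 pq2; ring.
transitivity (a * (a * q - 2 * b * p) + 2 * b * (a * p + 2 * b * q));
  first by ring.
by rewrite pq1 pq2; ring.
Qed.

(* The third family of equations says that a (k - 2) is an eigenvalue of an  *)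
(* operator which is skew for the inner product with weights 'C(k, i).       *)
Lemma annihilator_skew k n wt i j :
    (0 < n)%N -> a * (2 - k%:R) != 0 -> annihilator k n wt ->
  (i + j)%N = k -> wt i j = 0.
Proof.
move=> n_gt0 ak_neq0 [_ _ /(_ n_gt0) wt3] ijk.
pose w i := wt i (k - i)%N; pose B i : R := ('C(k, i))%:R.
(* This is the equation at i' multiplied by [B i' * w i']. At both ends the missing neighbour has
   coefficient 0. *)
have wE i' : (i' <= k)%N -> a * (2 - k%:R) * w i' ^+ 2 * B i' =
    2 * b * (B i' * i'%:R * (w i' * w i'.-1)) - 2 * b * (B i' * (k
      - i')%:R * (w i' * w i'.+1)).
  move=> le_ik; have := wt3 i' (k - i')%N (subnKC le_ik).
  rewrite -/(w i') (_ : (k - i').-1 = (k - i'.+1)%N); last by lia.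
  rewrite -/(w i'.+1).
  have -> : 2 * b * i'%:R * wt i'.-1 (k - i').+1 = 2 * b * i'%:R * w i'.-1.
    case: i' le_ik => [|i'] le_ik; first by rewrite !(mulr0, mul0r).
    by rewrite /w /= -subSn.
  move=> e; transitivity (B i' * w i' * (a * (2 - k%:R) * w i')); first by ring.
  rewrite (_ : a * (2 - k%:R) * w i' =
    2 * b * i'%:R * w i'.-1 - 2 * b * (k - i')%:R * w i'.+1); first by ring.
  by move: e; lra.
have sum0 : \sum_(i < k.+1) w i ^+ 2 * B i = 0.
  apply: (mulfI ak_neq0); rewrite mulr0 mulr_sumr.
  under eq_bigr => i' _ do rewrite mulrA wE -1?ltnS //.
  rewrite sumrB -!mulr_sumr; apply/eqP; rewrite subr_eq0; apply/eqP;
    congr (_ * _).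
  (* After an index shift the two sums agree termwise, since 'C(k, i + 1) (i + 1) = 'C(k, i) (k -
     i). *)
  rewrite big_ord_recl /= mulr0 mul0r add0r big_ord_recr /= subnn mulr0 mul0r
    addr0.
  apply: eq_bigr => i' _; rewrite /bump /= add1n add0n.
  rewrite /B -!natrM [(_ * i'.+1)%N]mulnC mul_bin_left mulnC.
  by rewrite [w _ * w _]mulrC.
have lt_ik : (i < k.+1)%N by rewrite -ijk ltnS leq_addr.
have Bw_ge0 (t : 'I_k.+1) : true -> 0 <= w t ^+ 2 * B t.
  by rewrite mulr_ge0 ?sqr_ge0 ?ler0n.
have /eqP : w (Ordinal lt_ik) ^+ 2 * B (Ordinal lt_ik) = 0.
  exact: (psumr_eq0P Bw_ge0 sum0).
rewrite mulf_eq0 /B pnatr_eq0 -leqn0 leqNgt bin_gt0 -ltnS lt_ik orbF.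
by rewrite sqrf_eq0 /w /= -ijk addKn => /eqP.
Qed.

(** If i = 0 or j = 0, an equation reduces to a times the value. Otherwise the first two families
    express a times the value as multiples of the same sum S + S' of neighbours, with nonzero
    coefficients of opposite signs, so both vanish. *)
Lemma annihilator_n0 k wt i j :
  (0 < k)%N -> a != 0 -> annihilator k 0 wt -> (i + j)%N = k -> wt i j = 0.
Proof.
move=> k_gt0 a_neq0 [wt1 wt2 _] ijk.
case: i j ijk => [|i] [|j] ijk; first by rewrite -ijk in k_gt0.
- apply: (mulfI a_neq0); rewrite mulr0.
  have := wt2 0%N j ijk. lra.
- apply: (mulfI a_neq0); rewrite mulr0.
  have := wt1 i 0%N ijk. lra.
have := wt1 i j.+1 ijk.
have := wt2 i.+1 j; rewrite -addnS ijk => /(_ erefl) /=.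
set S := wt i j.+2; set S' := wt i.+2 j; set w := wt i.+1 j.+1.
rewrite -!natr1 => e2 e1.
have S0 : S + S' = 0.
  have i_j : i%:R + j%:R + 2 != 0 :> R by rewrite -!natrD pnatr_eq0 addn2.
  by apply: (mulfI (mulf_neq0 b_neq0 i_j)); move: e1 e2; lra.
apply: (mulfI a_neq0); rewrite mulr0.
transitivity (b * (i%:R + 1) * (S + S')); last by rewrite S0 mulr0.
by move: e2; lra.
Qed.

(** The n-th moment of a standard Gaussian variable: (n - 1)!! for even n, and 0 for odd n. *)
Fixpoint gauss_moment n : nat :=
  if n is m.+2 then m.+1 * gauss_moment m else (n == 0%N).

Lemma gauss_moment_gt0 n : (0 < gauss_moment (2 * n))%N.
Proof. by elim: n => // n IHn; rewrite mulnS /= muln_gt0 IHn. Qed.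

(** Gaussian integration by parts. *)
Lemma gauss_moment_pred n :
  (n * gauss_moment n.-1)%N = gauss_moment n.+1.
Proof. by case: n. Qed.

(* The integral of x1^i x2^j against the standard Gaussian measure, which is *)
(* rotation-invariant.                                                       *)
Definition gauss_wt i j : R := (gauss_moment i)%:R * (gauss_moment j)%:R.

(** For k = 2n the hypothesis removes every term containing a, as a (2 - k) = 2 a (1 - n). The
    remaining terms cancel by integration by parts: in the first family, for instance, both are b
    times the moments of orders i + 2 and j + 1, with opposite signs. *)
Lemma annihilator_gauss n :
  a * (1 - n%:R) = 0 -> annihilator (2 * n) n gauss_wt.
Proof.
move=> an0.
have momentE i : i%:R * (gauss_moment i.-1)%:R = (gauss_moment i.+1)%:R :> R.
  by rewrite -natrM gauss_moment_pred.
have moment2 i : (gauss_moment i.+2)%:R = (i%:R + 1) * (gauss_moment i)%:R :> R.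
  by rewrite /= natrM -natr1.
have nE i j : (i + j).+1 = (2 * n)%N -> 2 * n%:R = i%:R + j%:R + 1 :> R.
  by move=> e; rewrite -natrM -e -addn1 !natrD.
rewrite /gauss_wt; split=> [i j /nE kE|i j /nE kE|_ i j ijk].
- transitivity (- (a * (1 - n%:R)) * ((gauss_moment i.+1)%:R
      * (gauss_moment j)%:R)
    + b * (2 * n%:R - j%:R) * ((gauss_moment i)%:R * (gauss_moment j.+1)%:R)
    - b * (gauss_moment i.+2)%:R * (j%:R * (gauss_moment j.-1)%:R));
        first by ring.
  by rewrite an0 momentE kE moment2; ring.
- transitivity (- (a * (1 - n%:R)) * ((gauss_moment i)%:R
      * (gauss_moment j.+1)%:R)
    + b * (i%:R - 2 * n%:R) * ((gauss_moment i.+1)%:R * (gauss_moment j)%:R)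
    + b * (i%:R * (gauss_moment i.-1)%:R) * (gauss_moment j.+2)%:R);
        first by ring.
  by rewrite an0 momentE kE moment2; ring.
- rewrite [(2 * n)%:R]natrM.
  transitivity (2 * b * (gauss_moment i.+1)%:R * (j%:R * (gauss_moment j.-1)%:R)
    - 2 * b * (i%:R * (gauss_moment i.-1)%:R) * (gauss_moment j.+1)%:R
    + 2 * (a * (1 - n%:R)) * ((gauss_moment i)%:R * (gauss_moment j)%:R));
        first by ring.
  by rewrite an0 (momentE i) (momentE j); ring.
Qed.

(** The third family, which expresses rotation invariance, is now a recurrence stepping i by two: it
    forces 0 at i = 1, hence at odd i, and fixes the values at even i from the one at i = 0. *)
Lemma annihilator_gauss_uniq n wt i j :
    (0 < n)%N -> a * (1 - n%:R) = 0 -> annihilator (2 * n) n wt ->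
  (i + j)%N = (2 * n)%N ->
  wt i j = wt 0 (2 * n)%N / (gauss_moment (2 * n))%:R * gauss_wt i j.
Proof.
move=> n_gt0 an0 [_ _ /(_ n_gt0) wt3].
have {}wt3 i' j' : (i' + j')%N = (2 * n)%N ->
    j'%:R * wt i'.+1 j'.-1 = i'%:R * wt i'.-1 j'.+1.
  move=> ijk; have := wt3 i' j' ijk.
  have -> : a * (2 - (2 * n)%:R) = 0.
    by rewrite natrM -{1}[2]mulr1 -mulrBr mulrCA an0 mulr0.
  have b2_neq0 : 2 * b != 0 by rewrite mulf_neq0 // pnatr_eq0.
  by rewrite mul0r addr0 => e; apply: (mulfI b2_neq0); lra.
set c := wt 0%N _ / _.
elim/ltn_ind: i j => -[|[|i]] IHi j ijk.
- rewrite add0n in ijk; rewrite ijk /gauss_wt mul1r /c divfK //.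
  by rewrite pnatr_eq0 -lt0n gauss_moment_gt0.
- have := wt3 0%N j.+1; rewrite add0n mul0r => /(_ ijk)/eqP.
  by rewrite mulf_eq0 pnatr_eq0 /= /gauss_wt mul0r mulr0 => /eqP.
- have ijk1 : (i.+1 + j.+1)%N = (2 * n)%N by rewrite addnS.
  have /= := wt3 _ _ ijk1.
  rewrite [wt i j.+2]IHi ?addnS // /gauss_wt /= => e.
  have j_neq0 : j.+1%:R != 0 :> R by rewrite pnatr_eq0.
  by apply: (mulfI j_neq0); rewrite e !(natrM _ _.+1); ring.
Qed.

(* For p = false, true these are the real and imaginary parts of the         *)
(* restriction to (x1, x2) = (1, i).                                         *)
Definition zero_wt (p : bool) (i j : nat) : R :=
  (odd j == p)%:R * (-1) ^+ j./2.

Lemma zero_wt2 p i i' j : zero_wt p i j.+2 = - zero_wt p i' j.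
Proof. by rewrite /zero_wt /= negbK exprS mulN1r mulrN. Qed.

(** For a = n = 0 the equations only say that the functional kills the multiples of x1^2 + x2^2,
    that is, changes sign when x1^2 is replaced by x2^2. *)
Lemma annihilator_zero_wt k p : a = 0 -> annihilator k 0 (zero_wt p).
Proof.
move=> ->; split=> // -[|i] [|j] ijk;
  rewrite ?(zero_wt2 p _ i.+2) ?(zero_wt2 p _ 2%N) /=; ring.
Qed.

(** The sign rule steps j by two, so the values at j = 0 and j = 1 determine the others. *)
Lemma annihilator_zero_uniq k wt i j :
    a = 0 -> annihilator k.+1 0 wt -> (i + j)%N = k.+1 ->
  wt i j = wt k.+1 0%N * zero_wt false i j + wt k 1%N * zero_wt true i j.
Proof.
move=> a0 [wt1 _ _]; elim/ltn_ind: j i => -[|[|j]] IHj i ijk.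
- by rewrite addn0 in ijk; rewrite ijk /zero_wt /= expr0 mul0r mulr0 !mul1r
    mulr1 addr0.
- rewrite addn1 in ijk; case: ijk => ->.
  by rewrite /zero_wt /= expr0 mul0r mulr0 !mul1r mulr1 add0r.
have := wt1 i j.+1; rewrite -addnS ijk => /(_ erefl).
rewrite a0 !(mulr0, mul0r) add0r sub0r mulrN mulNr -opprD => /eqP.
rewrite oppr_eq0 /= -mulrDr !mulf_eq0 (negbTE b_neq0) pnatr_eq0 /= addr_eq0.
move=> /eqP ->; rewrite (IHj j) //; last by rewrite -ijk !addnS !addSn.
by rewrite !(zero_wt2 _ i i.+2); ring.
Qed.

End Annihilators.

(** * Complements of the exact series in each bidegree *)

Section Complements.
Variables (R : realType) (a b : R).
Hypothesis b_neq0 : b != 0.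
Implicit Types (f g h : fps3 R) (c : R) (wt : nat -> nat -> R) (k n m : nat).
Local Notation mon := (mon R).
Local Notation exact := (exact a b).
Local Notation annihilator := (annihilator a b).

(** Closure under differences is what turns the last clause into uniqueness of the representative in
    [W]. *)
Definition exact_complement k n (W : set (fps3 R)) : Prop :=
  [/\ forall v, W v -> hpart k n v = v,
      forall u v, W u -> W v -> W (u - v),
      forall f, exists2 v, W v & exact (hpart k n f - v)
    & forall v, W v -> exact v -> v = 0].

Lemma eq_pairing wt wt' k n c f :
    (forall i j, (i + j)%N = k -> wt i j = c * wt' i j) ->
  pairing wt k n f = c * pairing wt' k n f.
Proof.
move=> wtE; rewrite mulr_sumr; apply: eq_bigr => i _.
by rewrite wtE ?mulrA // subnKC // -ltnS.
Qed.

(** If all annihilators are multiples of [wt], the cokernel has dimension at most one, and any u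
    with nonzero pairing spans a complement. *)
Lemma exact_complement_line k n wt u :
    annihilator k n wt ->
    (forall wt', annihilator k n wt' ->
       exists c, forall i j, (i + j)%N = k -> wt' i j = c * wt i j) ->
    hpart k n u = u -> pairing wt k n u != 0 ->
  exact_complement k n [set scal c * u | c in [set: R]].
Proof.
move=> wt_ann wt_uniq u_hom u_neq0; split.
- by move=> _ [c _ <-]; rewrite hpart_scal u_hom.
- move=> _ _ [c _ <-] [c' _ <-]; exists (c - c') => //.
  by rewrite rmorphB mulrBl.
- move=> f; set c := pairing wt k n f / pairing wt k n u.
  exists (scal c * u); first by exists c.
  have -> : hpart k n f - scal c * u = hpart k n (f - scal c * u).
    by rewrite raddfB /= hpart_scal u_hom.
  apply: exact_pairing => wt' /wt_uniq[c' /eq_pairing ->].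
  by rewrite raddfB /= pairing_scal divfK // subrr mulr0.
- move=> _ [c _ <-] /(pairing_exact wt_ann)/eqP; rewrite pairing_scal.
  by rewrite mulf_eq0 (negbTE u_neq0) orbF => /eqP ->; rewrite rmorph0 mul0r.
Qed.

Lemma exact_hpart k n f :
    (forall wt i j, annihilator k n wt -> (i + j)%N = k -> wt i j = 0) ->
  exact (hpart k n f).
Proof.
move=> wt0; apply: exact_pairing => wt wt_ann.
rewrite (@eq_pairing wt (fun _ _ => 0) _ _ 0) ?mul0r // => i j ijk.
by rewrite (wt0 wt) ?mul0r.
Qed.

(** The skew argument needs n > 0 and k <> 2. If k = 2, then n <> 1 makes the bidegree generic; if n
    = 0, then k > 0 and [annihilator_n0] applies. *)
Lemma exact_hpart_a_neq0 k n f :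
  a != 0 -> (k, n) != (0, 0)%N -> (k, n) != (2, 1)%N -> exact (hpart k n f).
Proof.
move=> a_neq0 kn00 kn21; apply: exact_hpart => wt i j wt_ann.
have [n0|n_gt0] := posnP n.
  rewrite n0 in wt_ann kn00; have k_gt0 : (0 < k)%N by case: (k) kn00.
  exact: annihilator_n0 wt_ann.
have [k2|k_neq2] := eqVneq k 2%N.
  apply: annihilator_generic wt_ann => //; rewrite k2 //.
  by move: kn21; rewrite k2 xpair_eqE eqxx /=; lia.
apply: annihilator_skew wt_ann => //.
by rewrite mulf_neq0 // subr_eq0 eqr_nat eq_sym.
Qed.

Lemma exact_hpart_generic k n f :
    (0 < k)%N -> (0 < n)%N -> k != (2 * n)%N -> exact (hpart k n f).
Proof.
move=> k_gt0 n_gt0 kn; apply: exact_hpart => wt i j wt_ann.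
exact: annihilator_generic wt_ann.
Qed.

(** For k = 0 the only possible equation is 2 a [wt 0 0] = 0, and it occurs only for n > 0. *)
Lemma exact_complement_x3 n :
  (n == 0%N) || (a == 0) ->
  exact_complement 0 n [set scal c * x3 ^+ n | c in [set: R]].
Proof.
move=> na; have x3E : x3 ^+ n = mon 0 0 n by rewrite /mon !expr0 !mul1r.
apply: (@exact_complement_line 0 n (fun _ _ => 1)).
- split=> // n_gt0 [|//] [|//] _; move: na;
    rewrite -[n == _]negbK -lt0n n_gt0 /=.
  by move=> /eqP ->; ring.
- by move=> wt' _; exists (wt' 0%N 0%N) => -[|//] [|//] _; rewrite mulr1.
- by rewrite x3E hpart_mon !eqxx.
- by rewrite x3E pairing_mon ?oner_neq0.
Qed.

Lemma D_powE n : ((x1 ^+ 2 + x2 ^+ 2) * x3) ^+ n =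
  \sum_(i < n.+1) mon (2 * (n - i)) (2 * i) n *+ 'C(n, i).
Proof.
rewrite exprMn exprDn mulr_suml; apply: eq_bigr => i _.
by rewrite /mon !exprM mulrnAl.
Qed.

(** The expansion of D^n has positive coefficients and only even exponents of x1 and x2, so its
    pairing with the Gaussian moments is a sum of positive terms. *)
Lemma exact_complement_D n :
    (0 < n)%N -> a * (1 - n%:R) = 0 ->
  exact_complement (2 * n) n
    [set scal c * ((x1 ^+ 2 + x2 ^+ 2) * x3) ^+ n | c in [set: R]].
Proof.
move=> n_gt0 an0; rewrite D_powE.
have idx (i : 'I_n.+1) : (2 * (n - i) + 2 * i = 2 * n)%N.
  by have := ltn_ord i; lia.
apply: (@exact_complement_line _ n (gauss_wt R)).
- exact: annihilator_gauss.
- by move=> wt' wt'_ann; eexists => i j; apply: annihilator_gauss_uniq wt'_ann.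
- rewrite raddf_sum; apply: eq_bigr => i _.
  by rewrite raddfMn /= hpart_mon idx !eqxx.
have termE (i : 'I_n.+1) :
    pairing (gauss_wt R) (2 * n) n (mon (2 * (n - i)) (2 * i) n *+ 'C(n, i)) =
    gauss_wt R (2 * (n - i)) (2 * i) *+ 'C(n, i).
  by rewrite raddfMn /= pairing_mon ?idx.
rewrite raddf_sum /=; under eq_bigr do rewrite termE.
have gauss_gt0 i j : 0 < gauss_wt R (2 * i) (2 * j).
  by rewrite mulr_gt0 // ltr0n gauss_moment_gt0.
rewrite gt_eqF // big_ord_recl; apply: ltr_pwDl.
  by rewrite bin0 mulr1n gauss_gt0.
by apply: sumr_ge0 => i _; rewrite mulrn_wge0 // ltW // gauss_gt0.
Qed.

(** The functionals [zero_wt false] and [zero_wt true] are dual to the monomials x1^(m+1) and x1^m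
    x2. *)
Lemma exact_complement_linear m :
    a = 0 ->
  exact_complement m.+1 0
    [set x1 ^+ m * (scal c.1 * x1 + scal c.2 * x2) | c in [set: R * R]].
Proof.
move=> a0; pose F (c : R * R) := scal c.1 * mon m.+1 0 0 + scal c.2 * mon m 1 0.
have FE (c : R * R) : x1 ^+ m * (scal c.1 * x1 + scal c.2 * x2) = F c.
  by rewrite /F /mon !expr0 !mulr1 exprSr expr1; ring.
have pairF p (c : R * R) : pairing (zero_wt R p) m.+1 0 (F c)
  = if p then c.2 else c.1.
  rewrite raddfD /= !pairing_scal !pairing_mon ?addn0 ?addn1 // /zero_wt /=
    expr0.
  by case: p; rewrite /= ?(mul0r, mulr0, mul1r, mulr1, addr0, add0r).
split.
- move=> _ [c _ <-]; rewrite FE /F raddfD /= !hpart_scal !hpart_mon.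
  by rewrite addn0 addn1 !eqxx.
- move=> _ _ [c _ <-] [c' _ <-]; exists (c - c') => //.
  by rewrite /= !rmorphB; ring.
- move=> f; pose c := (pairing (zero_wt R false) m.+1 0 f,
    pairing (zero_wt R true) m.+1 0 f).
  exists (F c); first by exists c.
  have -> : hpart m.+1 0 f - F c = hpart m.+1 0 (f - F c).
    by rewrite raddfB /= /F [hpart _ _ (_
      + _)]raddfD /= !hpart_scal !hpart_mon addn0 addn1 !eqxx.
  apply: exact_pairing => wt wt_ann.
  have -> : pairing wt m.+1 0 (f - F c) =
      wt m.+1 0%N * pairing (zero_wt R false) m.+1 0 (f - F c)
      + wt m 1%N * pairing (zero_wt R true) m.+1 0 (f - F c).
    rewrite !mulr_sumr -big_split /=; apply: eq_bigr => i _.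
    rewrite (annihilator_zero_uniq b_neq0 a0 wt_ann);
      first by rewrite mulrDl !mulrA.
    by rewrite subnKC // -ltnS.
  by rewrite !raddfB /= !pairF !subrr !mulr0 addr0.
- move=> _ [c _ <-]; rewrite FE => Fc.
  have c0 p := pairing_exact (annihilator_zero_wt b m.+1 p a0) Fc.
  have := c0 false; have := c0 true; rewrite !pairF /F => -> ->.
  by rewrite !rmorph0 !mul0r addr0.
Qed.

End Complements.

(** * Components of multivector fields *)

Section Subsets3.
Implicit Types p q r : bool.

Lemma sum_ord3 (V : nmodType) (F : 'I_3 -> V) :
  \sum_(i < 3) F i = F i1 + F i2 + F i3.
Proof.
by rewrite !big_ord_recl big_ord0 addr0 addrA; congr (F _ + F _ + F _);
  apply: val_inj.
Qed.

Lemma card_ord3 (P : pred 'I_3) : #|[set i | P i]%SET| = (P i1 + P i2 + P i3)%N.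
Proof.
rewrite -sum1dep_card big_mkcond /= sum_ord3.
by case: (P i1) (P i2) (P i3) => [] [] [].
Qed.

(** Three booleans encode a set of indices, so that components of multivector fields can be computed
    by cases. *)
Definition set3 p q r : {set 'I_3} :=
  [set i : 'I_3 | nth false [:: p; q; r] i]%SET.

Lemma set3_onto (J : {set 'I_3}) : J = set3 (i1 \in J) (i2 \in J) (i3 \in J).
Proof. by apply/setP => i; rewrite inE; elim/ord3_ind: i. Qed.

Lemma in_set3 p q r : ((i1 \in set3 p q r) = p) * ((i2 \in set3 p q r) = q)
  * ((i3 \in set3 p q r) = r).
Proof. by rewrite !inE. Qed.

Lemma set1_set3 :
  ([set i1]%SET = set3 true false false) * ([set i2]%SET
    = set3 false true false)
  * ([set i3]%SET = set3 false false true).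
Proof. by split; [split|]; rewrite [LHS]set3_onto !inE. Qed.

Lemma eq_set3 p q r p' q' r' :
  (set3 p q r == set3 p' q' r') = [&& p == p', q == q' & r == r'].
Proof.
apply/eqP/and3P => [e|[/eqP-> /eqP-> /eqP->] //].
have eJ i := congr1 (fun J : {set 'I_3} => i \in J) e.
by have := (eJ i1, eJ i2, eJ i3) => -[[]]; rewrite !in_set3 => -> -> ->.
Qed.

Lemma sub_set3 p q r p' q' r' :
  (set3 p q r \subset set3 p' q' r') = [&& p ==> p', q ==> q' & r ==> r'].
Proof.
apply/fintype.subsetP/and3P => [e|[pp' qq' rr'] i].
  by split; apply/implyP; [have := e i1 | have := e i2 | have := e i3];
    rewrite !in_set3.
by elim/ord3_ind: i; rewrite !in_set3; apply/implyP.
Qed.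

Lemma setD_set3 p q r p' q' r' :
  (set3 p q r :\: set3 p' q' r')%SET
    = set3 (p && ~~ p') (q && ~~ q') (r && ~~ r').
Proof.
by rewrite [LHS]set3_onto !finset.in_setD !in_set3; congr set3; rewrite andbC.
Qed.

Lemma setU1_set3 p q r :
  ((i1 |: set3 p q r)%SET = set3 true q r) * ((i2 |: set3 p q r)%SET
    = set3 p true r)
  * ((i3 |: set3 p q r)%SET = set3 p q true).
Proof. by split; [split|]; rewrite [LHS]set3_onto !inE. Qed.

Lemma card_set3 p q r : #|set3 p q r| = (p + q + r)%N.
Proof. by rewrite card_ord3. Qed.

Lemma sum_set3 (V : nmodType) (F : {set 'I_3} -> V) :
  \sum_J F J = \sum_p \sum_q \sum_r F (set3 p q r).
Proof.
rewrite pair_bigA /= pair_bigA /=.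
rewrite (reindex (fun t : bool * bool * bool => set3 t.1.1 t.1.2 t.2)) //.
exists (fun J : {set 'I_3} => (i1 \in J, i2 \in J,
  i3 \in J)) => [[[p q] r] _|J _] /=.
  by rewrite !in_set3.
by rewrite -set3_onto.
Qed.

End Subsets3.

(** * Wedge product and Schouten bracket in components *)

Section Schouten.
Variables (R : realType).
Implicit Types (f g h : fps3 R) (A B X Y : mvf R) (c : R) (p q r : bool).

Lemma shuffle_sign_set3 p q r p' q' r' :
  shuffle_sign R (set3 p q r) (set3 p' q' r') =
  (-1) ^+ (q && p' + r && p' + r && q')%N.
Proof.
rewrite /shuffle_sign -sum1dep_card big_mkcond /=; congr (_ ^+ _).
rewrite -(pair_bigA _ (fun i j : 'I_3 =>
  if [&& i \in set3 p q r, j \in set3 p' q' r' & (j < i)%N] then 1%N else 0%N))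
    /=.
rewrite sum_ord3 !(sum_ord3 (V := nat)) !in_set3 /= !andbF !andbT.
by case: p q r p' q' r' => [] [] [] [] [] [].
Qed.

Lemma wedge_set3 A B p q r :
  wedge A B (set3 p q r) = \sum_p' \sum_q' \sum_r'
    if [&& p' ==> p, q' ==> q & r' ==> r] then
      (-1) ^+ (q' && (p && ~~ p') + r' && (p && ~~ p') + r' && (q && ~~ q'))%N *
      (A (set3 p' q' r') * B (set3 (p && ~~ p') (q && ~~ q') (r && ~~ r')))
    else 0.
Proof.
rewrite ffunE big_mkcond sum_set3.
do 3!(apply: eq_bigr => ? _); rewrite sub_set3; case: ifP => // _.
by rewrite setD_set3 shuffle_sign_set3.
Qed.

Lemma multivectors_sub d A : multivectors d A ->
  forall p q r, (p + q + r)%N != d -> A (set3 p q r) = 0.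
Proof. by move=> Ad p q r pqr; apply: Ad; rewrite card_set3. Qed.

Lemma mvfP A B : (forall p q r, A (set3 p q r) = B (set3 p q r)) -> A = B.
Proof. by move=> AB; apply/ffunP => J; rewrite (set3_onto J). Qed.

Lemma pd_set3 p q r :
  (pd i1 (set3 p q r) = ([&& p, ~~ q & ~~ r])%:R :> fps3 R)
  * (pd i2 (set3 p q r) = ([&& ~~ p, q & ~~ r])%:R :> fps3 R)
  * (pd i3 (set3 p q r) = ([&& ~~ p, ~~ q & r])%:R :> fps3 R).
Proof.
by split; [split|]; rewrite ffunE set1_set3 eq_set3; case: p q r => [] [] [].
Qed.

Lemma dzeta_right_set3 A p q r :
  (dzeta_right i1 A (set3 p q r) = if p then 0 else (-1) ^+ (q
    + r)%N * A (set3 true q r))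
  * (dzeta_right i2 A (set3 p q r)
    = if q then 0 else (-1) ^+ r * A (set3 p true r))
  * (dzeta_right i3 A (set3 p q r) = if r then 0 else A (set3 p q true)).
Proof.
split; [split|]; rewrite ffunE in_set3; case: ifP => // _;
  rewrite setU1_set3 card_ord3 !in_set3 /= ?andbF ?andbT ?add0n ?addn0 //.
by rewrite mul1r.
Qed.

Lemma dzeta_left_set3 A p q r :
  (dzeta_left i1 A (set3 p q r) = if p then 0 else A (set3 true q r))
  * (dzeta_left i2 A (set3 p q r)
    = if q then 0 else (-1) ^+ p * A (set3 p true r))
  * (dzeta_left i3 A (set3 p q r) = if r then 0 else (-1) ^+ (p
    + q)%N * A (set3 p q true)).
Proof.
split; [split|]; rewrite ffunE in_set3; case: ifP => // _;
  rewrite setU1_set3 card_ord3 !in_set3 /= ?andbF ?andbT ?add0n ?addn0 //.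
by rewrite mul1r.
Qed.

Lemma dx_mvf_set3 n A J : dx_mvf n A J = dx n (A J).
Proof. by rewrite ffunE. Qed.

Lemma mvf_addE A B J : (A + B) J = A J + B J.
Proof. by rewrite ffunE. Qed.

Lemma mvf_oppE A J : (- A) J = - A J.
Proof. by rewrite ffunE. Qed.

Lemma mvf_scaleE f A J : (f *: A) J = f * A J.
Proof. by rewrite ffunE. Qed.

Lemma multivectors_wedge d e A B : multivectors d A -> multivectors e B ->
  multivectors (d + e) (wedge A B).
Proof.
move=> Ad Be J ne_J; rewrite ffunE big1 // => I sIJ.
have [dI|neI] := eqVneq #|I| d; last by rewrite (Ad I) // mul0r mulr0.
rewrite (Be (J :\: I)%SET) ?mulr0 // cardsD (finset.setIidPr sIJ) dI.
by move: ne_J (subset_leq_card sIJ); rewrite dI; lia.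
Qed.

Lemma multivectors_dzeta_right d n A :
  multivectors d.+1 A -> multivectors d (dzeta_right n A).
Proof.
move=> Ad J ne_J; rewrite ffunE; case: ifP => // nJ.
by rewrite Ad ?mulr0 // cardsU1 nJ eqSS.
Qed.

Lemma multivectors_dzeta_left d n A :
  multivectors d.+1 A -> multivectors d (dzeta_left n A).
Proof.
move=> Ad J ne_J; rewrite ffunE; case: ifP => // nJ.
by rewrite Ad ?mulr0 // cardsU1 nJ eqSS.
Qed.

Lemma multivectors_dx d n A : multivectors d A -> multivectors d (dx_mvf n A).
Proof. by move=> Ad J ne_J; rewrite ffunE Ad // raddf0. Qed.

Lemma multivectorsD d A B :
  multivectors d A -> multivectors d B -> multivectors d (A + B).
Proof. by move=> Ad Bd J ne_J; rewrite ffunE Ad // Bd // addr0. Qed.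

Lemma multivectorsZ d f A : multivectors d A -> multivectors d (f *: A).
Proof. by move=> Ad J ne_J; rewrite ffunE Ad // scaler0. Qed.

Lemma multivectorsN d A : multivectors d A -> multivectors d (- A).
Proof. by move=> Ad J ne_J; rewrite ffunE Ad // oppr0. Qed.

Lemma multivectors_pd n : multivectors 1 (pd n : mvf R).
Proof. by move=> J ne_J; rewrite ffunE; case: (J =P _) ne_J => // ->;
  rewrite cards1. Qed.

Lemma multivectors_schouten d e A B :
    multivectors d.+1 A -> multivectors e.+1 B ->
  multivectors (d + e).+1 (schouten A B).
Proof.
move=> Ad Be; rewrite /schouten sum_ord3.
suff summand n : multivectors (d + e).+1
    (wedge (dzeta_right n A) (dx_mvf n B)
      - wedge (dx_mvf n A) (dzeta_left n B)).
  by do 2!apply: multivectorsD => //.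
apply: multivectorsD.
  rewrite -addnS; apply: multivectors_wedge; last exact: multivectors_dx.
  exact: multivectors_dzeta_right.
apply: multivectorsN; rewrite -addSn.
apply: multivectors_wedge; first exact: multivectors_dx.
exact: multivectors_dzeta_left.
Qed.

Lemma wedge12 A B : multivectors 1 A -> multivectors 2 B ->
  wedge A B (set3 true true true) =
    A (set3 true false false) * B (set3 false true true)
    - A (set3 false true false) * B (set3 true false true)
    + A (set3 false false true) * B (set3 true true false).
Proof.
move=> /multivectors_sub A1 /multivectors_sub B2.
rewrite wedge_set3 !big_bool /= !(A1 true true) // !(A1 _ true true) //.
by rewrite !(A1 true false true) // !(A1 false false false) //; ring.
Qed.

Lemma wedge21 A B : multivectors 2 A -> multivectors 1 B ->
  wedge A B (set3 true true true) =
    A (set3 false true true) * B (set3 true false false)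
    - A (set3 true false true) * B (set3 false true false)
    + A (set3 true true false) * B (set3 false false true).
Proof.
move=> /multivectors_sub A1 /multivectors_sub B2.
rewrite wedge_set3 !big_bool /= !(A1 false false) // !(A1 _ false false) //.
by rewrite !(A1 false true false) // !(A1 true true true) //; ring.
Qed.

End Schouten.

Section SchoutenDegree3.
Variables (R : realType).
Implicit Types (f g h : fps3 R) (A B X Y : mvf R) (c : R) (p q r : bool).

(** This is - (A . curl B + B . curl A) in the frame pd23, pd31, pd12; the component at
    [set3 true false true] is minus the coefficient of pd31. *)
Lemma schouten22 A B : multivectors 2 A -> multivectors 2 B ->
  schouten A B (set3 true true true) =
    A (set3 false true true) * (- dx i3 (B (set3 true false true))
      - dx i2 (B (set3 true true false)))
  + A (set3 true false true) * (dx i3 (B (set3 false true true))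
      - dx i1 (B (set3 true true false)))
  + A (set3 true true false) * (dx i1 (B (set3 true false true))
      + dx i2 (B (set3 false true true)))
  + B (set3 false true true) * (- dx i3 (A (set3 true false true))
      - dx i2 (A (set3 true true false)))
  + B (set3 true false true) * (dx i3 (A (set3 false true true))
      - dx i1 (A (set3 true true false)))
  + B (set3 true true false) * (dx i1 (A (set3 true false true))
      + dx i2 (A (set3 false true true))).
Proof.
move=> A2 B2; rewrite /schouten sum_ord3 !(mvf_addE, mvf_oppE).
have Ar n : multivectors 1 (dzeta_right n A) by exact: multivectors_dzeta_right.
have Bl n : multivectors 1 (dzeta_left n B) by exact: multivectors_dzeta_left.
have Ad n : multivectors 2 (dx_mvf n A) by exact: multivectors_dx.
have Bd n : multivectors 2 (dx_mvf n B) by exact: multivectors_dx.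
rewrite !(wedge12 (Ar _) (Bd _)) !(wedge21 (Ad _) (Bl _)).
rewrite !(dzeta_right_set3, dzeta_left_set3, dx_mvf_set3) /=.
ring.
Qed.

End SchoutenDegree3.

(** * The Poisson tensor and its differential on bivector fields *)

Section PoissonTensor.
Variables (R : realType).
Implicit Types (f g h : fps3 R) (A B X Y : mvf R) (c : R) (p q r : bool).

Lemma wedge11 X Y : multivectors 1 X -> multivectors 1 Y ->
  (wedge X Y (set3 true true false) =
     X (set3 true false false) * Y (set3 false true false)
     - X (set3 false true false) * Y (set3 true false false))
  * (wedge X Y (set3 true false true) =
     X (set3 true false false) * Y (set3 false false true)
     - X (set3 false false true) * Y (set3 true false false))
  * (wedge X Y (set3 false true true) =
     X (set3 false true false) * Y (set3 false false true)
     - X (set3 false false true) * Y (set3 false true false)).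
Proof.
move=> /multivectors_sub X1 /multivectors_sub Y1.
by split; [split|]; rewrite wedge_set3 !big_bool /=;
  rewrite ?(X1 true true) ?(X1 false true true) ?(X1 true false true) //;
  rewrite ?(X1 false false false) //;
  rewrite !(mul0r, mulr0, add0r, addr0, expr0, expr1, mul1r, mulN1r) //= addrC.
Qed.

Lemma multivectors_set3_eq d A B :
    multivectors d A -> multivectors d B ->
    (forall p q r, (p + q + r)%N = d -> A (set3 p q r) = B (set3 p q r)) ->
  A = B.
Proof.
move=> /multivectors_sub Ad /multivectors_sub Bd AB; apply: mvfP => p q r.
by have [/AB //|ne_d] := eqVneq (p + q + r)%N d; rewrite Ad ?Bd.
Qed.

Local Hint Resolve multivectors_pd : core.

Lemma multivectors_pd2 : multivectors 2 (pd23 R) /\ multivectors 2 (pd31 R) /\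
  multivectors 2 (pd12 R).
Proof. by split; [|split]; apply: (@multivectors_wedge _ 1 1). Qed.

Lemma multivectors_pd123 : multivectors 3 (pd123 : mvf R).
Proof.
by apply: (@multivectors_wedge _ 2 1) => //; case: multivectors_pd2 => _ [].
Qed.

Lemma pd123_set3 : pd123 (set3 true true true) = 1 :> fps3 R.
Proof.
rewrite /pd123 wedge21; last by []; last by case: multivectors_pd2 => _ [].
by rewrite !wedge11 // !pd_set3 /=; ring.
Qed.

Lemma multivectors3E A :
  multivectors 3 A -> A = A (set3 true true true) *: pd123.
Proof.
move=> A3; apply: multivectors_set3_eq A3 _ _.
  exact/multivectorsZ/multivectors_pd123.
by move=> [] [] [] // _; rewrite mvf_scaleE pd123_set3 mulr1.
Qed.

Definition bivector f g h : mvf R := f *: pd23 R + g *: pd31 R + h *: pd12 R.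

Lemma multivectors_bivector f g h : multivectors 2 (bivector f g h).
Proof.
have [p1 [p2 p3]] := multivectors_pd2.
by do 2?apply: multivectorsD; apply: multivectorsZ.
Qed.

Lemma mvf_lin3E f g h A B X J :
  (f *: A + g *: B + h *: X) J = f * A J + g * B J + h * X J.
Proof. by rewrite !ffunE. Qed.

Lemma bivectorE f g h J :
  bivector f g h J = f * pd23 R J + g * pd31 R J + h * pd12 R J.
Proof. exact: mvf_lin3E. Qed.

Lemma bivector_set3 f g h :
  (bivector f g h (set3 false true true) = f)
  * (bivector f g h (set3 true false true) = - g)
  * (bivector f g h (set3 true true false) = h).
Proof.
have wedge_pd m n := wedge11 (@multivectors_pd R m) (@multivectors_pd R n).
rewrite !bivectorE /pd23 /pd31 /pd12 !wedge_pd !pd_set3 /=.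
by split; [split|]; ring.
Qed.

Lemma multivectors2E A : multivectors 2 A ->
  A = bivector (A (set3 false true true)) (- A (set3 true false true))
        (A (set3 true true false)).
Proof.
move=> A2; apply: multivectors_set3_eq A2 (multivectors_bivector _ _ _) _.
by move=> [] [] [] // _; rewrite bivector_set3 ?opprK.
Qed.

Lemma Y1_set3 :
  (Y1 (set3 true false false) = x1 :> fps3 R)
  * (Y1 (set3 false true false) = x2 :> fps3 R)
  * (Y1 (set3 false false true) = 0 :> fps3 R).
Proof.
have Y1E J : (Y1 : mvf R) J = x1 * pd i1 J + x2 * pd i2 J.
  by rewrite /Y1 ffunE; congr (_ + _); rewrite ffunE.
by split; [split|]; rewrite Y1E !pd_set3 /= ?mulr1 ?mulr0 ?addr0 ?add0r.
Qed.

Lemma Y2_set3 :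
  (Y2 (set3 true false false) = - x2 :> fps3 R)
  * (Y2 (set3 false true false) = x1 :> fps3 R)
  * (Y2 (set3 false false true) = 0 :> fps3 R).
Proof.
have Y2E J : (Y2 : mvf R) J = x1 * pd i2 J - x2 * pd i1 J.
  by rewrite /Y2 ffunE; congr (_ + _); rewrite ffunE ?ffunE.
by split; [split|]; rewrite Y2E !pd_set3 /= ?mulr1 ?mulr0 ?subr0 ?sub0r.
Qed.

Lemma Y3_set3 :
  (Y3 (set3 true false false) = 0 :> fps3 R)
  * (Y3 (set3 false true false) = 0 :> fps3 R)
  * (Y3 (set3 false false true) = x3 :> fps3 R).
Proof.
have Y3E J : (Y3 : mvf R) J = x3 * pd i3 J by rewrite /Y3 ffunE.
by split; [split|]; rewrite Y3E !pd_set3 /= ?mulr1 ?mulr0.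
Qed.

Lemma multivectors_Y :
  [/\ multivectors 1 (Y1 : mvf R), multivectors 1 (Y2 : mvf R)
    & multivectors 1 (Y3 : mvf R)].
Proof.
split.
- by apply: multivectorsD; apply: multivectorsZ.
- by apply: multivectorsD; [|apply: multivectorsN]; apply: multivectorsZ.
- by apply: multivectorsZ.
Qed.

Lemma Y123E : Y123 = ((x1 ^+ 2 + x2 ^+ 2) * x3) *: pd123 :> mvf R.
Proof.
(* Generalization keeps conversion from comparing the Y's by unfolding. *)
have [] := multivectors_Y; rewrite /Y123; move: Y1_set3 Y2_set3 Y3_set3.
move: (Y1 : mvf R) (Y2 : mvf R) (Y3 : mvf R) => X Y Z XE YE ZE X_1 Y_1 Z_1.
have XY_2 : multivectors 2 (wedge X Y) by apply: (@multivectors_wedge _ 1 1).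
have XYZ_3 : multivectors 3 (wedge (wedge X Y) Z) by apply:
  (@multivectors_wedge _ 2 1).
rewrite [LHS](multivectors3E XYZ_3) (wedge21 XY_2 Z_1) !(wedge11 X_1 Y_1).
by rewrite !XE !YE !ZE; congr (_ *: _); ring.
Qed.

Variables a b : R.

Definition Lambda : mvf R := scal b *: wedge Y1 Y2 + scal (2 * b) *: wedge Y2 Y3
  + scal a *: wedge Y3 Y1.

Lemma LambdaE : Lambda = bivector
  (x3 * (scal (2 * b) * x1 - scal a * x2))
  (x3 * (scal (2 * b) * x2 + scal a * x1))
  (scal b * (x1 ^+ 2 + x2 ^+ 2)).
Proof.
have [] := multivectors_Y; rewrite /Lambda; move: Y1_set3 Y2_set3 Y3_set3.
move: (Y1 : mvf R) (Y2 : mvf R) (Y3 : mvf R) => X Y Z XE YE ZE X_1 Y_1 Z_1.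
set L := _ + _.
have LE J : L J = scal b * wedge X Y J + scal (2 * b) * wedge Y Z J
  + scal a * wedge Z X J by exact: mvf_lin3E.
have L2 : multivectors 2 L.
  by do 2?apply: multivectorsD; apply: multivectorsZ;
    apply: (@multivectors_wedge _ 1 1).
rewrite [LHS](multivectors2E L2) !LE !(wedge11 X_1 Y_1) !(wedge11 Y_1 Z_1)
  !(wedge11 Z_1 X_1).
rewrite !XE !YE !ZE.
have eq_bivector f f' g g' h h' : f = f' -> g = g' -> h = h' ->
  bivector f g h = bivector f' g' h' by move=> -> -> ->.
by apply: eq_bivector; ring.
Qed.

(** Since curl Lambda = (- a x1, - a x2, 2 a x3), the part B . curl Lambda is the last term of
    [delta]. *)
Lemma schouten_Lambda f g h :
  schouten Lambda (bivector f g h) = - delta a b f g h *: pd123.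
Proof.
have := bivector_set3 f g h; have := multivectors_bivector f g h.
move: (bivector f g h) => B B2 BE.
have := multivectors_bivector (x3 * (scal (2 * b) * x1 - scal a * x2))
  (x3 * (scal (2 * b) * x2 + scal a * x1)) (scal b * (x1 ^+ 2 + x2 ^+ 2)).
have := bivector_set3 (x3 * (scal (2 * b) * x1 - scal a * x2))
  (x3 * (scal (2 * b) * x2 + scal a * x1)) (scal b * (x1 ^+ 2 + x2 ^+ 2)).
rewrite -LambdaE; move: Lambda => L LE L2.
have LB3 := @multivectors_schouten _ 1 1 _ _ L2 B2.
rewrite [LHS](multivectors3E LB3).
congr (_ *: _).
rewrite (schouten22 L2 B2) !LE !BE /delta.
have x1d n : dx n (x1 : fps3 R) = (n == i1)%:R.
  by rewrite -[x1]mulr1; elim/ord3_ind: n;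
    rewrite ?(dx1_x1, dx2_x1, dx3_x1) dxr1 mulr0 ?addr0.
have x2d n : dx n (x2 : fps3 R) = (n == i2)%:R.
  by rewrite -[x2]mulr1; elim/ord3_ind: n;
    rewrite ?(dx1_x2, dx2_x2, dx3_x2) dxr1 mulr0 ?addr0.
rewrite !(raddfN (dx _)) /=.
rewrite !(dx1_x3, dx2_x3, dx3_x3) !(raddfB (dx _)) !(raddfD (dx _)) /=.
rewrite !dx_scal !x1d !x2d /=.
rewrite ?raddfB ?raddfD /= !expr2 !(dx1_x1, dx1_x2, dx2_x1, dx2_x2, dx1_x3,
  dx2_x3, dx3_x3) !x1d !x2d /=.
ring.
Qed.

End PoissonTensor.

(** * Cohomology in degree 3 *)

Section TopCohomology.
Variables (R : realType) (a b : R).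
Implicit Types (f g h : fps3 R) (A B : mvf R) (kr : nat * nat).
Local Notation L := (Lambda a b).

Lemma scale_pd123E f : (f *: pd123 : mvf R) (set3 true true true) = f.
Proof.
exact: etrans (mvf_scaleE _ _ _) (etrans (congr1 _ (@pd123_set3 R)) (mulr1 f)).
Qed.

Lemma multivectors_scale_pd123 f : multivectors 3 (f *: pd123).
Proof. exact/multivectorsZ/multivectors_pd123. Qed.

Lemma scale_pd123_inj f g : f *: pd123 = g *: pd123 :> mvf R -> f = g.
Proof.
move=> /(congr1 (fun A : mvf R => A (set3 true true true))) fg.
exact: etrans (esym (scale_pd123E f)) (etrans fg (scale_pd123E g)).
Qed.

(** The bracket is a 4-vector field in three dimensions. *)
Lemma schouten_Lambda_pd123 f : schouten L (f *: pd123) = 0.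
Proof.
have L2 : multivectors 2 L by rewrite LambdaE; exact: multivectors_bivector.
have f3 := multivectors_scale_pd123 f.
apply/ffunP => J; rewrite (@multivectors_schouten _ 1 2 _ _ L2 f3) ?ffunE //.
by rewrite ltn_eqF // ltnS (leq_trans (max_card _)) // card_ord.
Qed.

Lemma cocycles_multivectors3 A :
  cocycles L multivectors 3 A <-> exists f, A = f *: pd123.
Proof.
split=> [[/multivectors3E ->] _|[f ->]]; first by eexists.
by split; [exact: multivectors_scale_pd123 | exact: schouten_Lambda_pd123].
Qed.

Lemma cocycles_bigraded3 kr A : (kr.1 <= kr.2)%N ->
  cocycles L (bigraded kr) 3 A <->
  exists2 f, hpart kr.1 (kr.2 - kr.1)%N f = f & A = f *: pd123.
Proof.
move=> le_kr; rewrite /cocycles /bigraded /=;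
  split=> [[[f + ->] _]|[f f_hom ->]].
  by move=> /Pkr_hpart; rewrite subzn //; exists f.
split; last exact: schouten_Lambda_pd123.
by exists f => //; apply/Pkr_hpart; rewrite subzn.
Qed.

Lemma coboundaries_multivectors3 f :
  coboundaries L multivectors 3 (f *: pd123) <-> exact a b f.
Proof.
split=> [[B /multivectors2E ->]|[u [v [w ->]]]].
  rewrite schouten_Lambda => /scale_pd123_inj <-.
  by apply: exactN; do 3!eexists.
exists (bivector (- u) (- v) (- w)); first exact: multivectors_bivector.
rewrite schouten_Lambda; congr (_ *: _).
have := delta_scal a b (-1) u v w; rewrite rmorphN rmorph1 !mulN1r => ->.
by rewrite opprK.
Qed.

(** By [hpart_delta], any primitive of a homogeneous series can be replaced by its homogeneous
    parts, so exactness inside the bidegree agrees with exactness among all series. *)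
Lemma coboundaries_bigraded3 kr f :
    (kr.1 <= kr.2)%N -> hpart kr.1 (kr.2 - kr.1)%N f = f ->
  coboundaries L (bigraded kr) 3 (f *: pd123) <-> exact a b f.
Proof.
move=> le_kr f_hom; split=> [[_ [u [v [w [_ _ _ ->]]]]]|[u [v [w fE]]]].
  rewrite schouten_Lambda => /scale_pd123_inj <-.
  by apply: exactN; do 3!eexists.
set k := kr.1%:Z; set n := (kr.2 - kr.1)%N%:Z.
exists (bivector (- hpart (k - 1) n u) (- hpart (k - 1) n v)
          (- hpart k (n - 1) w)).
  have rkE : kr.2%:Z - 1 - (k - 1) = n by rewrite /k /n -subzn //; lia.
  have rkE' : kr.2%:Z - 1 - k = n - 1 by rewrite /k /n -subzn //; lia.
  have PkrN k' r' x : Pkr k' r' (- hpart k' (r' - k') x).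
    by apply/Pkr_hpart; rewrite raddfN /= hpart_id.
  exists (- hpart (k - 1) n u), (- hpart (k - 1) n v), (- hpart k (n - 1) w).
  split; last reflexivity.
  - by rewrite -rkE; exact: PkrN.
  - by rewrite -rkE; exact: PkrN.
  - by rewrite -rkE'; exact: PkrN.
rewrite schouten_Lambda; congr (_ *: _).
have := delta_scal a b (-1) (hpart (k - 1) n u) (hpart (k - 1) n v)
  (hpart k (n - 1) w).
rewrite rmorphN rmorph1 !mulN1r => ->.
by rewrite opprK -hpart_delta -fE f_hom.
Qed.

End TopCohomology.

(** * Assembling the bidegrees *)

Section DirectSum.
Variables (R : realType) (a b : R) (T : choiceType) (kr : T -> nat * nat).
Variable W : T -> set (fps3 R).
Hypothesis kr_le : forall t, ((kr t).1 <= (kr t).2)%N.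
Hypothesis kr_inj : injective kr.
Implicit Types (f g h : fps3 R) (A B : mvf R) (F : T -> fps3 R).
Local Notation L := (Lambda a b).
Local Notation hpart_at t := (hpart (kr t).1 ((kr t).2 - (kr t).1)%N).
Local Notation V := (fun t => [set f *: pd123 | f in W t] : set (mvf R)).

Definition fps3_sum F : fps3 R := fun i j l => \sum_(t \in [set: T]) F t i j l.

(** The exponents of a monomial determine its bidegree and [kr] is injective, so each coefficient of
    the sum has at most one nonzero term. *)
Lemma hpart_fps3_sum F t :
  (forall t, hpart_at t (F t) = F t) -> hpart_at t (fps3_sum F) = F t.
Proof.
move=> F_hom; apply/fps3P => i j l; rewrite /hpart; case: ifP => ijl;
  last first.
  by rewrite -F_hom /hpart ijl.
rewrite /fps3_sum -(@fsbig_widen _ _ _ _ [set t]) ?fsbig_set1 // =>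
  s [_ /= ne_st].
rewrite -F_hom /hpart; case: ifP => // ijl'; case: ne_st; apply: kr_inj.
move: (kr_le s) (kr_le t) ijl ijl'; case: (kr s) (kr t) => [k r] [k' r'] /= *.
by congr pair; lia.
Qed.

Lemma formal_sum_pd123 F :
  formal_sum (fun t => F t *: pd123) = fps3_sum F *: pd123.
Proof.
apply: (@multivectors_set3_eq _ 3).
- move=> J ne_J; rewrite ffunE; apply/fps3P => i j l; rewrite fsbig1 // => t _.
  by rewrite (multivectors_scale_pd123 (F t)).
- exact: multivectors_scale_pd123.
move=> [] [] [] // _; rewrite scale_pd123E ffunE.
apply/fps3P => i j l; apply: eq_fsbigr => t _.
by rewrite scale_pd123E.
Qed.

Lemma summable_pd123 F :
  (forall t, hpart_at t (F t) = F t) -> summable (fun t => F t *: pd123).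
Proof.
move=> F_hom J i j l.
have [[t tP]|no_t] := pselect (exists t, (F t *: pd123 : mvf R) J i j l != 0).
  apply: (sub_finite_set _ (finite_set1 t)) => s /= sP.
  have degE u : (F u *: pd123 : mvf R) J i j l != 0 ->
      kr u = ((i + j)%N, (i + j + l)%N).
    have [|ne_J] := eqVneq #|J| 3%N; last first.
      by rewrite (multivectors_scale_pd123 (F u)) // eqxx.
    rewrite (set3_onto J) card_set3.
    case: (i1 \in J) (i2 \in J) (i3 \in J) => [] [] [] // _.
    rewrite scale_pd123E -F_hom /hpart; case: ifP; rewrite ?eqxx //.
    move: (kr_le u); case: (kr u) => [k r] /= *.
    by congr pair; lia.
  by apply: kr_inj; rewrite !degE.
rewrite (_ : [set _ | _] = set0) //; apply/seteqP; split=> // t /= tP.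
by case: no_t; exists t.
Qed.

Hypothesis W_compl : forall t,
  exact_complement a b (kr t).1 ((kr t).2 - (kr t).1)%N (W t).
Hypothesis exact_other : forall (k n : nat) f,
  (forall t, kr t <> (k, k + n)%N) -> exact a b (hpart k n f).

Lemma exact_fps3P f : (forall t, exact a b (hpart_at t f)) -> exact a b f.
Proof.
move=> f_exact; apply: exact_hpartP => k n.
have [[t kn]|no_t] := pselect (exists t, kr t = (k, k + n)%N).
  by have := f_exact t; rewrite kn /= addKn.
by apply: exact_other => t kn; case: no_t; exists t.
Qed.

Lemma complement_hom F :
  (forall t, W t (F t)) -> forall t, hpart_at t (F t) = F t.
Proof. by move=> WF t; have [/(_ _ (WF t))] := W_compl t. Qed.

Lemma families_pd123 (P : T -> set (fps3 R)) (v : T -> mvf R) :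
    families (fun t => [set f *: pd123 | f in P t]) v ->
  exists2 F, forall t, P t (F t) & v = fun t => F t *: pd123.
Proof.
move=> vV; have /choice[F FP] : forall t, exists f, P t f /\ v t = f *: pd123.
  by move=> t; have [f Pf <-] := vV t; exists f.
by exists F => [t|]; [case: (FP t) | apply/funext => t; case: (FP t)].
Qed.

Lemma families_cocycles v :
    families (fun t => cocycles L (bigraded (kr t)) 3) v ->
  exists2 F, forall t, hpart_at t (F t) = F t & v = fun t => F t *: pd123.
Proof.
move=> Zv; apply: (@families_pd123 (fun t f => hpart_at t f = f)) => t.
by have /cocycles_bigraded3[//|f f_hom ->] := Zv t; exists f.
Qed.

(** All four claims become statements on series. By [exact_fps3P] exactness need only be tested in
    the bidegrees [kr t], and there [W t] is a complement of the exact series. *)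
Theorem top_cohomology_dsum :
  [/\ cohomology_is_dsum L 3 kr,
      forall t, cohomology_is L (bigraded (kr t)) 3 (V t),
      dsum_is_direct V
    & cohomology_is L multivectors 3 (formal_dsum V)].
Proof.
split; [split|move=> t|split|].
- move=> _ /families_cocycles[F F_hom ->]; split; first exact: summable_pd123.
  by rewrite formal_sum_pd123; apply/cocycles_multivectors3; eexists.
- move=> _ /families_cocycles[F F_hom ->].
  rewrite formal_sum_pd123 coboundaries_multivectors3; split=> [BF|F_exact t].
    apply: exact_fps3P => t; rewrite hpart_fps3_sum //.
    by have := BF t; rewrite coboundaries_bigraded3.
  rewrite coboundaries_bigraded3 // -(hpart_fps3_sum t F_hom).
  exact: hpart_exact.
- move=> _ /cocycles_multivectors3[f ->].
  have F_hom t : hpart_at t (hpart_at t f) = hpart_at t f by rewrite hpart_id.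
  exists (fun t => hpart_at t f *: pd123) => [t|].
    by apply/cocycles_bigraded3 => //; eexists.
  rewrite (formal_sum_pd123 (fun t => hpart_at t f)) -scalerBl.
  apply/coboundaries_multivectors3/exact_fps3P => t.
  by rewrite raddfB /= (hpart_fps3_sum t F_hom) subrr; exact: exact0.
- have [W_hom W_sub W_ex W_inj] := W_compl t; split=> [_ [f Wf <-]|].
    by apply/cocycles_bigraded3 => //; exists f => //; exact: W_hom.
  move=> _ /cocycles_bigraded3[//|f f_hom ->].
  have [v Wv fv] := W_ex f; rewrite f_hom in fv.
  exists (v *: pd123); split.
    split; first by exists v.
    rewrite -scalerBl; apply/coboundaries_bigraded3 => //.
    by rewrite raddfB /= f_hom W_hom.
  move=> _ [[w Ww <-] fw].
  have {}fw : exact a b (f - w).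
    apply/(coboundaries_bigraded3 _ _ (kr_le t)); last by rewrite scalerBl.
    by rewrite raddfB /= f_hom W_hom.
  (* The difference of two representatives lies in [W t] and is exact. *)
  suff vw : v - w = 0 by rewrite (subr0_eq vw).
  apply: W_inj; first exact: W_sub.
  by rewrite (_ : v - w = (f - w) - (f - v)); [exact: exactB | ring].
- move=> _ /families_pd123[F WF ->]; apply: summable_pd123.
  exact: complement_hom.
- move=> _ _ /set_mem /families_pd123[F WF ->] /set_mem /families_pd123[G WG
    ->].
  move=> FG; have {}FG : fps3_sum F = fps3_sum G.
    apply: scale_pd123_inj.
    exact: etrans (esym (formal_sum_pd123 F)) (etrans FG (formal_sum_pd123 G)).
  suff -> : F = G by []; apply/funext => t.
  rewrite -(hpart_fps3_sum t (complement_hom WF)) FG.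
  by rewrite (hpart_fps3_sum t (complement_hom WG)).
split=> [_ [_ /families_pd123[F WF ->] <-]|].
  by rewrite formal_sum_pd123; apply/cocycles_multivectors3; eexists.
move=> _ /cocycles_multivectors3[f ->].
have /choice[F FP] : forall t, exists v, W t v /\ exact a b (hpart_at t f - v).
  by move=> t; have [_ _ /(_ f)[v]] := W_compl t; exists v.
have WF t : W t (F t) by case: (FP t).
have F_hom := complement_hom WF.
exists (fps3_sum F *: pd123); split.
  split; first by exists (fun t => F t *: pd123);
    [move=> t; exists (F t) | exact: formal_sum_pd123].
  rewrite -scalerBl; apply/coboundaries_multivectors3/exact_fps3P => t.
  by rewrite raddfB /= hpart_fps3_sum //; case: (FP t).
move=> _ [[_ /families_pd123[G WG ->] <-]].
rewrite formal_sum_pd123 -scalerBl => /coboundaries_multivectors3 fG.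
suff -> : F = G by []; apply/funext => t; apply: subr0_eq.
have [_ W_sub _ W_inj] := W_compl t; apply: W_inj; first exact: W_sub.
rewrite (_ : F t - G t = (hpart_at t f - G t) - (hpart_at t f - F t));
  last by ring.
apply: exactB; last by case: (FP t).
have := hpart_exact (kr t).1 ((kr t).2 - (kr t).1)%N fG.
by rewrite raddfB /= (hpart_fps3_sum t (complement_hom WG)).
Qed.

End DirectSum.

Lemma line_scale_pd123 (R : realType) (f : fps3 R) :
  line (f *: pd123) = [set g *: pd123 | g in [set scal c * f | c in [set: R]]].
Proof.
apply/seteqP; split=> [_ [c _ <-]|_ [_ [c _ <-] <-]].
  by exists (scal c * f); [exists c | rewrite scalerA].
by exists c; [|rewrite scalerA].
Qed.

Unset Implicit Arguments.

Theorem theorem4 (R : realType) (a b : R) (hb : b != 0) :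
  let L : mvf R := scal b *: wedge Y1 Y2 + scal (2 * b) *: wedge Y2 Y3
                   + scal a *: wedge Y3 Y1 in
  let D : fps3 R := (x1 ^+ 2 + x2 ^+ 2) * x3 in
  (a != 0 ->
     let kr (t : bool) : nat * nat := if t then (2, 3)%N else (0, 0)%N in
     let V (t : bool) : set (mvf R) := if t then line Y123 else line pd123 in
     [/\ cohomology_is_dsum L 3 kr,
         forall t, cohomology_is L (bigraded (kr t)) 3 (V t),
         dsum_is_direct V
       & cohomology_is L multivectors 3 (formal_dsum V)])
  /\
  (a = 0 ->
     let kr (t : nat + nat + nat) : nat * nat :=
       match t with
       | inl (inl m) => (2 * m.+1, 3 * m.+1)%N
       | inl (inr m) => (0, m)%N
       | inr m => (m.+1, m.+1)
       end in
     let V (t : nat + nat + nat) : set (mvf R) :=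
       match t with
       | inl (inl m) => line (D ^+ m *: Y123)
       | inl (inr m) => line (x3 ^+ m *: pd123)
       | inr m => [set (x1 ^+ m * (scal c.1 * x1 + scal c.2 * x2)) *: pd123
                  | c in [set: R * R]]
       end in
     [/\ cohomology_is_dsum L 3 kr,
         forall t, cohomology_is L (bigraded (kr t)) 3 (V t),
         dsum_is_direct V
       & cohomology_is L multivectors 3 (formal_dsum V)]).
Proof.
move=> L D; split=> [a_neq0|a0] kr V.
(* The exponents 1 and 0 exhibit both lines as cases of the general complements, with n = 1 and n =
   0; [Y123] is D times [pd123]. *)
- pose W (t : bool) : set (fps3 R)
    := if t then [set scal c * D ^+ 1 | c in [set: R]]
    else [set scal c * x3 ^+ 0 | c in [set: R]].
  have -> : V = fun t => [set f *: pd123 | f in W t].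
    apply/funext => -[]; rewrite /V /W -line_scale_pd123;
      last by rewrite expr0 scale1r.
    by rewrite expr1 Y123E.
  apply: (@top_cohomology_dsum R a b).
  + by case.
  + by move=> [] [].
  + move=> []; last exact: exact_complement_x3.
    by apply: (exact_complement_D hb (n := 1)) => //; rewrite subrr mulr0.
  + move=> k n f kn; apply: (exact_hpart_a_neq0 hb) => //.
      by apply/eqP => -[k0 n0]; apply: (kn false); rewrite k0 n0.
    by apply/eqP => -[k0 n0]; apply: (kn true); rewrite k0 n0.
pose W (t : nat + nat + nat) : set (fps3 R) :=
  match t with
  | inl (inl m) => [set scal c * D ^+ m.+1 | c in [set: R]]
  | inl (inr m) => [set scal c * x3 ^+ m | c in [set: R]]
  | inr m => [set x1 ^+ m * (scal c.1 * x1 + scal c.2 * x2) | c in [set: R * R]]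
  end.
have -> : V = fun t => [set f *: pd123 | f in W t].
  apply/funext => -[[m|m]|m]; last 1 first.
  - apply/seteqP; split=> [_ [c _ <-]|_ [_ [c _ <-] <-]]; last by exists c.
    by eexists; [exists c|].
  (* The factor D in [Y123] shifts the exponent, so index m stands for n = m + 1. *)
  - have DY : D ^+ m *: Y123 = D ^+ m.+1 *: pd123 :> mvf R.
      by rewrite Y123E scalerA -exprSr.
    exact: etrans (congr1 (@line R) DY) (line_scale_pd123 _).
  - exact: line_scale_pd123.
apply: (@top_cohomology_dsum R a b).
- by move=> [[m|m]|m] //=; rewrite leq_mul2r orbT.
- move=> s t st; have := congr1 fst st; have := congr1 snd st; move: s t {st}.
  by move=> [[m|m]|m] [[m'|m']|m'] /= e2 e1;
    lia || (rewrite (_ : m = m') //; lia).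
- move=> [[m|m]|m] /=.
  + rewrite -mulnBl mul1n; apply: exact_complement_D => //.
    by rewrite a0 mul0r.
  + by rewrite subn0; apply: exact_complement_x3; rewrite a0 eqxx orbT.
  + by rewrite subnn; exact: exact_complement_linear.
move=> k n f kn.
(* The bidegrees with k = 0, n = 0 or k = 2n are all listed; any other is generic. *)
have [k0|k_gt0] := posnP k; first by case: (kn (inl (inr n))); rewrite /= k0.
have [n0|n_gt0] := posnP n.
  by case: (kn (inr k.-1)); rewrite /= n0 addn0 prednK.
apply: exact_hpart_generic => //; apply/eqP => k2n.
by case: (kn (inl (inl n.-1))); rewrite /= prednK // k2n -mulSnr.
Qed.
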